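(* Let $Q\subset\mathbb{E}^3$ be a polyhedron obtained by denting a strongly strictly convex triangulated polyhedral surface either at one edge, or at two edges which share a vertex but which are not both contained in a face. Then $Q$ is infinitesimally rigid.
   Context: $\mathbb{E}^3$ is Euclidean 3-space. A polyhedral surface is weakly strictly convex if for every vertex $\mathbf{p}_i$ there is a (support) plane that intersects the surface at exactly $\mathbf{p}_i$. A triangulated polyhedral surface is strongly strictly convex if, in addition, for every edge $e$ of the triangulated surface there is a (support) plane that intersects the surface at exactly $e$. Denting: a polyhedron $P$ is obtained by denting a convex polyhedron $R$ at an edge $e$ if $P$ has the same vertices as $R$ and the same faces, except that the two faces of $R$ adjacent to $e$ (which are required to be triangles) are replaced by the two other triangles, sharing an edge, such that the union of the two new triangles has the same boundary as the union of the two removed triangles. (That is, triangles $abc$ and $abd$ with $e=ab$ are replaced by $cda$ and $cdb$.) Denting at two edges means performing this replacement at both edges. Infinitesimal rigidity: for a polyhedron with triangular faces and vertices $\mathbf{p}_1,\dots,\mathbf{p}_n$, an infinitesimal flex (isometric first-order deformation) is an assignment of vectors $\mathbf{p}'_1,\dots,\mathbf{p}'_n\in\mathbb{R}^3$ with $(\mathbf{p}_i-\mathbf{p}_j)\cdot(\mathbf{p}'_i-\mathbf{p}'_j)=0$ for every edge $[\mathbf{p}_i,\mathbf{p}_j]$. It is trivial if it is the restriction to the vertices of the derivative of a family of rigid congruences of $\mathbb{E}^3$. The polyhedron is infinitesimally rigid if every infinitesimal flex is trivial. *)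

(* Defs.v *)
From HB Require Import structures.
From mathcomp Require Import all_boot all_order all_algebra.
From mathcomp Require Import all_classical all_reals all_analysis.

Set Implicit Arguments.
Unset Strict Implicit.
Unset Printing Implicit Defensive.

Import Order.TTheory GRing.Theory Num.Theory.
Import numFieldNormedType.Exports.

Local Open Scope ring_scope.

(* The Euclidean structure of E^3 is defined explicitly: the library norm on
   'rV[R]_3 is the sup norm, which has the same topology and derivatives but
   not the same isometries. *)
Definition dot (R : realType) (u v : 'rV[R]_3) : R :=
  \sum_(k < 3) u 0 k * v 0 k.

Definition edist (R : realType) (x y : 'rV[R]_3) : R :=
  Num.sqrt (dot (x - y) (x - y)).

(* A triangulated surface on the vertices p_0, ..., p_(n-1) is given by
   p : 'I_n -> 'rV[R]_3 and the set F of the vertex triples of its faces. *)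

Definition is_edge (n : nat) (F : {set {set 'I_n}}) (e : {set 'I_n}) : bool :=
  (#|e| == 2%N) && [exists f in F, e \subset f].

(* Convex hull of the points p_i, i \in f. *)
Definition cell (R : realType) (n : nat) (p : 'I_n -> 'rV[R]_3)
    (f : {set 'I_n}) : set 'rV[R]_3 :=
  [set x | exists w : 'I_n -> R,
    [/\ forall i, i \in f -> 0 <= w i,
        \sum_(i in f) w i = 1
      & x = \sum_(i in f) w i *: p i]]%classic.

Definition affinely_independent (R : realType) (n : nat)
    (p : 'I_n -> 'rV[R]_3) (f : {set 'I_n}) : Prop :=
  forall w : 'I_n -> R,
    \sum_(i in f) w i = 0 -> \sum_(i in f) w i *: p i = 0 ->
    forall i, i \in f -> w i = 0.

Definition surface (R : realType) (n : nat) (p : 'I_n -> 'rV[R]_3)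
    (F : {set {set 'I_n}}) : set 'rV[R]_3 :=
  (\bigcup_(f in [set` F]) cell p f)%classic.

(* Two faces around v sharing an edge through v. *)
Definition adjacent_at (n : nat) (F : {set {set 'I_n}}) (v : 'I_n) :
    rel {set 'I_n} :=
  fun f g => [&& f \in F, g \in F, v \in f, v \in g & #|f :&: g| == 2%N].

(* Connected, closed 2-dimensional simplicial complexes that are manifolds and
   are embedded in E^3.  Given poly_edge, the link of a vertex is a disjoint
   union of cycles; poly_link says that it is a single cycle. *)
Record polyhedron (R : realType) (n : nat) (p : 'I_n -> 'rV[R]_3)
    (F : {set {set 'I_n}}) : Prop := Polyhedron {
  poly_nonempty : F != finset.set0;
  poly_triangle : forall f, f \in F -> #|f| = 3%N;
  poly_vertex : forall v, exists2 f, f \in F & v \in f;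
  poly_edge : forall e, is_edge F e ->
    #|[set f in F | e \subset f]%SET| = 2%N;
  poly_link : forall v f g, f \in F -> g \in F -> v \in f -> v \in g ->
    connect (adjacent_at F v) f g;
  poly_connected : forall u v,
    connect (fun i j => is_edge F [set i; j]%SET) u v;
  poly_nondegenerate : forall f, f \in F -> affinely_independent p f;
  poly_embedded : forall f g, f \in F -> g \in F ->
    (cell p f `&` cell p g = cell p (f :&: g))%classic
}.

(* Some support plane of S, {x | <u, x> = c}, meets S exactly in A. *)
Definition support_plane_exactly (R : realType) (S A : set 'rV[R]_3) : Prop :=
  exists (u : 'rV[R]_3) (c : R),
    [/\ u != 0,
        (S `<=` [set x | dot u x <= c])%classic
      & (S `&` [set x | dot u x = c] = A)%classic].

Definition weakly_strictly_convex (R : realType) (n : nat)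
    (p : 'I_n -> 'rV[R]_3) (F : {set {set 'I_n}}) : Prop :=
  forall i : 'I_n, support_plane_exactly (surface p F) [set p i]%classic.

Definition strongly_strictly_convex (R : realType) (n : nat)
    (p : 'I_n -> 'rV[R]_3) (F : {set {set 'I_n}}) : Prop :=
  weakly_strictly_convex p F /\
  forall e, is_edge F e -> support_plane_exactly (surface p F) (cell p e).

(* G is obtained from F by replacing the two faces abc, abd adjacent to the
   edge e = ab with cda, cdb. *)
Definition dent_at (n : nat) (F : {set {set 'I_n}}) (e : {set 'I_n})
    (G : {set {set 'I_n}}) : Prop :=
  exists a b c d : 'I_n,
    [/\ uniq [:: a; b; c; d],
        e = [set a; b]%SET,
        [set a; b; c]%SET \in F,
        [set a; b; d]%SET \in F
      & G = ((F :\: [set [set a; b; c]; [set a; b; d]])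
               :|: [set [set c; d; a]; [set c; d; b]])%SET].

Definition infinitesimal_flex (R : realType) (n : nat)
    (p : 'I_n -> 'rV[R]_3) (F : {set {set 'I_n}})
    (p' : 'I_n -> 'rV[R]_3) : Prop :=
  forall i j : 'I_n, is_edge F [set i; j]%SET ->
    dot (p i - p j) (p' i - p' j) = 0.

Definition congruence (R : realType) (g : 'rV[R]_3 -> 'rV[R]_3) : Prop :=
  forall x y, edist (g x) (g y) = edist x y.

(* v is the derivative at time 0 of a family (g t) of congruences of E^3,
   starting at the identity. *)
Definition congruence_derivative (R : realType)
    (v : 'rV[R]_3 -> 'rV[R]_3) : Prop :=
  exists g : R -> 'rV[R]_3 -> 'rV[R]_3,
    [/\ forall t, congruence (g t),
        forall x, g 0 x = x
      & forall x, is_derive (0 : R) (1 : R) (fun t => g t x) (v x)].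

Definition trivial_flex (R : realType) (n : nat)
    (p : 'I_n -> 'rV[R]_3) (p' : 'I_n -> 'rV[R]_3) : Prop :=
  exists2 v : 'rV[R]_3 -> 'rV[R]_3,
    congruence_derivative v & forall i, p' i = v (p i).

Definition infinitesimally_rigid (R : realType) (n : nat)
    (p : 'I_n -> 'rV[R]_3) (F : {set {set 'I_n}}) : Prop :=
  forall p' : 'I_n -> 'rV[R]_3,
    infinitesimal_flex p F p' -> trivial_flex p p'.

(* Main.v *)
Require Import Defs.
From mathcomp Require Import all_boot all_order all_algebra.
From mathcomp Require Import all_classical all_reals all_analysis.
From mathcomp Require Import ring lra.

Set Implicit Arguments.
Unset Strict Implicit.
Unset Printing Implicit Defensive.

Import Order.TTheory GRing.Theory Num.Theory.
Import numFieldNormedType.Exports.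

Local Open Scope ring_scope.

(** Let a be the common vertex of the dented edges (or an end of the dented edge),
    take it as origin, and normalize an infinitesimal flex v of the dented surface
    so that a is fixed. The denting only removes faces that contain a, hence the
    cap, made of the faces of the convex surface that avoid a, is flexed by v.
    The proof studies the radial velocities z_i = (p_i - a) . v_i.

    Every face of the convex surface has a support plane (face_support). In a face
    of the cap, let rho be its angular velocity and N the linear form equal to 1 on
    its plane. Across an edge ij the numbers rho . N jump by a multiple of
    (p_j - a) . (v_j - v_i), and by convexity the factor m_ij is, up to
    orientation, positive (convex_roof). The jumps around a vertex add up to zero (sum_flux). Thus the
    radial velocities satisfy, at the vertices i that are not joined to a, a linear
    equation with positive weights on the neighbours of i, which the positive
    values of a support form at a satisfy as well. This gives a minimum principle
    (radial_min_principle): z is nonnegative as soon as it is so on the link of a.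

    A dent at the edge ab with adjacent faces abc and abd makes the triangle bcd
    rigid, and keeps all the neighbours of a except b, so that z vanishes on the
    link of a except at the tips b of the dents. Subtract from v the rigid motion of
    bcd: z_i becomes z_i - s A(p_i - a), where s = z_b and A is the linear form
    that vanishes at c and d and equals 1 at b. Now b is fixed, so the sum of
    m_bj z_j over its neighbours is zero, which together with the minimum principle
    is absurd if z - s A is positive on the link away from b, c, d
    (no_flex_pinned_on_ear). By convexity A is negative there; for a single dent
    this excludes s > 0 and, replacing v by -v, also s < 0. For two dents with tips
    b and b', forms A and A', and radial velocities s and t, what is left is
    |t| >= |A(b')| |s| and |s| >= |A'(b)| |t| with opposite signs; but
    A(b') A'(b) is a cross-ratio larger than 1 (ear_cross_ratio), so s = t = 0.

    Then z vanishes everywhere, every face turns about a, adjacent faces turn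
    alike, and v is an infinitesimal rotation (radial_free_flex). *)

(** * Vectors of the Euclidean space *)

Section VectorAlgebra.

Variable R : realType.
Implicit Types (u v w x y z : 'rV[R]_3) (c : R).

Definition ax0 : 'I_3 := Ordinal (isT : 0 < 3)%N.
Definition ax1 : 'I_3 := Ordinal (isT : 1 < 3)%N.
Definition ax2 : 'I_3 := Ordinal (isT : 2 < 3)%N.

Definition cross u v : 'rV[R]_3 :=
  \row_k (if k == ax0 then u 0 ax1 * v 0 ax2 - u 0 ax2 * v 0 ax1
          else if k == ax1 then u 0 ax2 * v 0 ax0 - u 0 ax0 * v 0 ax2
          else u 0 ax0 * v 0 ax1 - u 0 ax1 * v 0 ax0).

Definition det3 u v w : R := dot u (cross v w).

Lemma dotE u v :
  dot u v = u 0 ax0 * v 0 ax0 + u 0 ax1 * v 0 ax1 + u 0 ax2 * v 0 ax2.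
Proof.
rewrite /dot !big_ord_recl big_ord0 addr0 addrA.
by congr (_ * _ + _ * _ + _ * _); congr (_ 0 _); apply: val_inj.
Qed.

Lemma cross0 u v : cross u v 0 ax0 = u 0 ax1 * v 0 ax2 - u 0 ax2 * v 0 ax1.
Proof. by rewrite mxE. Qed.

Lemma cross1 u v : cross u v 0 ax1 = u 0 ax2 * v 0 ax0 - u 0 ax0 * v 0 ax2.
Proof. by rewrite mxE. Qed.

Lemma cross2 u v : cross u v 0 ax2 = u 0 ax0 * v 0 ax1 - u 0 ax1 * v 0 ax0.
Proof. by rewrite mxE. Qed.

Lemma row3P u v :
  u 0 ax0 = v 0 ax0 -> u 0 ax1 = v 0 ax1 -> u 0 ax2 = v 0 ax2 -> u = v.
Proof.
move=> h0 h1 h2; apply/rowP => -[[|[|[|//]]] k3].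
- by rewrite (_ : Ordinal k3 = ax0) //; apply: val_inj.
- by rewrite (_ : Ordinal k3 = ax1) //; apply: val_inj.
- by rewrite (_ : Ordinal k3 = ax2) //; apply: val_inj.
Qed.

Lemma addvE u v k : (u + v) 0 k = u 0 k + v 0 k. Proof. by rewrite mxE. Qed.
Lemma oppvE u k : (- u) 0 k = - u 0 k. Proof. by rewrite mxE. Qed.
Lemma scalevE c u k : (c *: u) 0 k = c * u 0 k. Proof. by rewrite mxE. Qed.
Lemma zerovE k : (0 : 'rV[R]_3) 0 k = 0. Proof. by rewrite mxE. Qed.

Definition coordE :=
  (dotE, cross0, cross1, cross2, addvE, oppvE, scalevE, zerovE).

End VectorAlgebra.

Ltac vec_ring := rewrite /det3 ?coordE; ring.
Ltac row_ring := apply: row3P; rewrite /det3 ?coordE; ring.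

Section VectorIdentities.

Variable R : realType.
Implicit Types (u v w x y z : 'rV[R]_3) (c : R).

Lemma dotDl u v w : dot (u + v) w = dot u w + dot v w. Proof. by vec_ring. Qed.
Lemma dotDr u v w : dot w (u + v) = dot w u + dot w v. Proof. by vec_ring. Qed.
Lemma dotBl u v w : dot (u - v) w = dot u w - dot v w. Proof. by vec_ring. Qed.
Lemma dotBr u v w : dot w (u - v) = dot w u - dot w v. Proof. by vec_ring. Qed.
Lemma dotNl u w : dot (- u) w = - dot u w. Proof. by vec_ring. Qed.
Lemma dotNr u w : dot w (- u) = - dot w u. Proof. by vec_ring. Qed.
Lemma dotZl c u w : dot (c *: u) w = c * dot u w. Proof. by vec_ring. Qed.
Lemma dotZr c u w : dot w (c *: u) = c * dot w u. Proof. by vec_ring. Qed.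
Lemma dot0l u : dot 0 u = 0. Proof. by vec_ring. Qed.
Lemma dot0r u : dot u 0 = 0. Proof. by vec_ring. Qed.
Lemma dotC u v : dot u v = dot v u. Proof. by vec_ring. Qed.

Lemma det3_perm x y z :
  (det3 x z y = - det3 x y z) * (det3 y x z = - det3 x y z) *
  (det3 z y x = - det3 x y z) * (det3 y z x = det3 x y z) *
  (det3 z x y = det3 x y z).
Proof. by do !split; vec_ring. Qed.

Lemma dot_sumr (I : finType) (P : pred I) (u : 'rV[R]_3) (f : I -> 'rV[R]_3) :
  dot u (\sum_(i | P i) f i) = \sum_(i | P i) dot u (f i).
Proof.
by elim/big_rec2: _ => [|i y1 y2 _ <-]; rewrite ?dot0r // dotDr.
Qed.

Lemma dot_ge0 u : 0 <= dot u u.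
Proof. by rewrite dotE -!expr2 !addr_ge0 ?sqr_ge0. Qed.

Lemma dot_eq0 u : dot u u = 0 -> u = 0.
Proof.
rewrite dotE -!expr2 => h.
have := sqr_ge0 (u 0 ax0); have := sqr_ge0 (u 0 ax1); have := sqr_ge0 (u 0 ax2).
move=> h2 h1 h0.
by apply: row3P; rewrite mxE; apply/eqP; rewrite -sqrf_eq0; apply/eqP; lra.
Qed.

Lemma dot_gt0 u : u != 0 -> 0 < dot u u.
Proof.
move=> u0; rewrite lt_neqAle dot_ge0 andbT eq_sym.
by apply: contra u0 => /eqP/dot_eq0 ->.
Qed.

End VectorIdentities.

(** * Infinitesimal rotations are derivatives of congruences *)

Section Rotations.

Variable R : realType.
Implicit Types (u v w x y z : 'rV[R]_3) (c t : R).

(** Cayley's rational parametrization of the rotations about the axis w. *)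
Definition cayley w t x : 'rV[R]_3 :=
  x + (t / (1 + t ^+ 2 * (dot w w / 4))) *: cross w x
    + (t ^+ 2 / 2 / (1 + t ^+ 2 * (dot w w / 4))) *: cross w (cross w x).

Lemma cayley_den w t : 1 + t ^+ 2 * (dot w w / 4) != 0.
Proof.
rewrite gt_eqF // ltr_pwDl // mulr_ge0 ?sqr_ge0 // divr_ge0 ?dot_ge0 //.
Qed.

Lemma cayleyB w t x y : cayley w t x - cayley w t y = cayley w t (x - y).
Proof. by rewrite /cayley; row_ring. Qed.

Lemma dot_cayley w t x : dot (cayley w t x) (cayley w t x) = dot x x.
Proof.
have := cayley_den w t; rewrite /cayley !coordE => h; field.
by move: h; apply: contra => /eqP h; apply/eqP; move: h; rewrite expr2; lra.
Qed.

Lemma is_derive_scalel (f : R -> R) (t df : R) w :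
  is_derive t 1 f df -> is_derive t 1 (fun s => f s *: w) (df *: w).
Proof.
move=> fdf.
suff h : ((fun h : R => h^-1 *: (((fun s => f s *: w) \o shift t) (h *: 1)
    - f t *: w)) @ (0 : R)^' --> df *: w)%classic.
  apply: DeriveDef; first by apply/cvg_ex; exists (df *: w).
  by apply: (cvg_lim _ h); apply: norm_hausdorff.
rewrite (_ : (fun _ => _) =
    (fun h : R => (h^-1 *: ((f \o shift t) (h *: 1) - f t)) *: w)).
  apply: cvgZr_tmp; rewrite -(@derive_val _ _ _ t 1 f df fdf).
  exact: (@ex_derive _ _ _ t 1 f df fdf).
by apply/funext => h /=; rewrite -scalerBl scalerA.
Qed.

Lemma rotation_congruence_derivative w u x0 :
  congruence_derivative (fun x => u + cross w (x - x0)).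
Proof.
exists (fun t x => x0 + t *: u + cayley w t (x - x0)); split.
- move=> t x y; rewrite /Defs.edist -(dot_cayley w t (x - y)).
  rewrite opprD addrACA subrr add0r cayleyB.
  by rewrite opprB addrA subrK.
- move=> x; rewrite /cayley expr2 !mul0r !scale0r !addr0.
  by rewrite addrC subrK.
- move=> x; rewrite /cayley.
  set y := x - x0; set k := dot w w / 4.
  pose den (t : R) := 1 + t ^+ 2 * k.
  have dden : is_derive (0 : R) 1 den 0.
    by apply: trigger_derive; rewrite /= /GRing.scale /=; ring.
  have dinv : is_derive (0 : R) 1 (fun t => (den t)^-1) 0.
    have den0 : den 0 != 0 by exact: cayley_den.
    apply: (@is_derive_eq _ _ _ _ _ _ _ _ (is_deriveV den0 dden)).
    by rewrite scaler0.
  have d1 : is_derive (0 : R) 1 (fun t => t / den t) 1.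
    apply: (@is_derive_eq _ _ _ _ _ _ _ _ (is_deriveM (is_derive_id (0:R) 1) dinv)).
    by rewrite /= scaler0 add0r /den expr2 !mul0r addr0 invr1 scale1r.
  have d2 : is_derive (0 : R) 1 (fun t => t ^+ 2 / 2 / den t) 0.
    have dsq : is_derive (0 : R) 1 (fun t : R => t ^+ 2 / 2) 0.
      by apply: trigger_derive; rewrite /= /GRing.scale /=; ring.
    apply: (@is_derive_eq _ _ _ _ _ _ _ _ (is_deriveM dsq dinv)).
    by rewrite /= !scaler0 addr0.
  have dt := is_derive_scalel u (is_derive_id (0 : R) 1).
  have du := is_deriveD (is_derive_cst x0 (0 : R) 1) dt.
  have dv := is_deriveD (is_deriveD (is_derive_cst y (0 : R) 1)
     (is_derive_scalel (cross w y) d1)) (is_derive_scalel (cross w (cross w y)) d2).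
  apply: (@is_derive_eq _ _ _ _ _ _ _ _ (is_deriveD du dv)).
  by rewrite !add0r !scale1r scale0r addr0.
Qed.

End Rotations.

(** * Combinatorics of closed triangulated surfaces *)

Section ClosedSurfaces.

Variables (R : realType) (n : nat) (p : 'I_n -> 'rV[R]_3).
Variable K : {set {set 'I_n}}.
Hypothesis K_poly : polyhedron p K.

Local Open Scope set_scope.

Implicit Types (i j k l x y z u : 'I_n) (f g h : {set 'I_n}).

Definition nbr (F : {set {set 'I_n}}) i j : bool := is_edge F [set i; j].

Lemma set3_rot i j k : [set i; j; k] = [set k; i; j].
Proof. by rewrite finset.setUC finset.setUA. Qed.

Lemma nbrC (F : {set {set 'I_n}}) i j : nbr F i j = nbr F j i.
Proof. by rewrite /nbr finset.setUC. Qed.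

Lemma nbr_neq (F : {set {set 'I_n}}) i j : nbr F i j -> i != j.
Proof. by rewrite /nbr /is_edge cards2 => /andP[]; case: (i != j). Qed.

Lemma nbrP (F : {set {set 'I_n}}) i j :
  reflect (i != j /\ exists f, [/\ f \in F, i \in f & j \in f]) (nbr F i j).
Proof.
apply: (iffP idP) => [ij|[ij [f [fF fi fj]]]].
  split; first exact: nbr_neq ij.
  case/andP: ij => _ /existsP[f /andP[fF /fintype.subsetP sf]].
  by exists f; split=> //; apply: sf; rewrite !inE eqxx ?orbT.
rewrite /nbr /is_edge cards2 ij /=; apply/existsP; exists f; rewrite fF /=.
by apply/fintype.subsetP => u; rewrite !inE => /orP[] /eqP ->.
Qed.

Lemma face_third f i j : f \in K -> i \in f -> j \in f -> i != j ->
  exists k, [/\ f = [set i; j; k], k != i & k != j].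
Proof.
move=> fK fi fj ij; have f3 := poly_triangle K_poly fK.
have sf : [set i; j] \subset f.
  by apply/fintype.subsetP => u; rewrite !inE => /orP[] /eqP ->.
have /cards1P[k kE] : #|f :\: [set i; j]| == 1%N.
  by rewrite cardsD (finset.setIidPr sf) f3 cards2 ij.
have : k \in f :\: [set i; j] by rewrite kE inE.
rewrite !inE negb_or => /andP[/andP[ki kj] _].
exists k; split=> //; apply/setP => u.
have := congr1 (fun A : {set 'I_n} => u \in A) kE; rewrite !inE.
case: (eqVneq u i) => [->|ui] /=; first by rewrite fi.
by case: (eqVneq u j) => [->|uj] /=; first by rewrite fj.
Qed.

Lemma face_vertices f : f \in K -> exists x y z,
  [/\ f = [set x; y; z], x != y, x != z & y != z].
Proof.
move=> fK; have /card_gt1P[x [y [fx fy xy]]] : (1 < #|f|)%N.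
  by rewrite (poly_triangle K_poly fK).
have [z [fE zx zy]] := face_third fK fx fy xy.
by exists x, y, z; split; rewrite // eq_sym.
Qed.

Lemma face_uniq i j k : [set i; j; k] \in K -> [/\ i != j, i != k & j != k].
Proof.
move=> /(poly_triangle K_poly).
rewrite -finset.setUA cardsU1 cards2 !inE.
by case: (eqVneq i j); case: (eqVneq i k); case: (eqVneq j k).
Qed.

Lemma face_nbr f i j : f \in K -> i \in f -> j \in f -> i != j -> nbr K i j.
Proof. by move=> fK fi fj ij; apply/nbrP; split=> //; exists f. Qed.

Lemma card_faces_edge i j : nbr K i j ->
  #|[set f in K | (i \in f) && (j \in f)]| = 2%N.
Proof.
move=> ij; rewrite -(poly_edge K_poly ij); apply: eq_card => f; rewrite !inE.
by rewrite finset.subUset !finset.sub1set.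
Qed.

Lemma edge_faces i j : nbr K i j -> exists k k',
  [/\ k != k', [set i; j; k] \in K, [set i; j; k'] \in K
    & forall f, f \in K -> i \in f -> j \in f ->
        f = [set i; j; k] \/ f = [set i; j; k']].
Proof.
move=> ij; have /eqP/cards2P[f [g [fg E]]] := card_faces_edge ij.
have : f \in [set f in K | (i \in f) && (j \in f)] by rewrite E !inE eqxx.
have : g \in [set f in K | (i \in f) && (j \in f)] by rewrite E !inE eqxx orbT.
rewrite !inE => /and3P[gK gi gj] /and3P[fK fi fj].
have [k [fE _ _]] := face_third fK fi fj (nbr_neq ij).
have [k' [gE _ _]] := face_third gK gi gj (nbr_neq ij).
exists k, k'; rewrite -fE -gE; split=> //.
  by apply: contraNneq fg => kk'; rewrite fE gE kk'.
move=> h hK hi hj.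
have : h \in [set f in K | (i \in f) && (j \in f)] by rewrite inE hK hi hj.
by rewrite E !inE => /orP[] /eqP ->; [left|right].
Qed.

Lemma other_face f i j : f \in K -> i \in f -> j \in f -> i != j ->
  exists k, [/\ [set i; j; k] \in K, k \notin f, [set i; j; k] != f &
    forall g, g \in K -> i \in g -> j \in g -> g = f \/ g = [set i; j; k]].
Proof.
move=> fK fi fj ij.
have [k [k' [kk' kK k'K H]]] := edge_faces (face_nbr fK fi fj ij).
have [_ ik jk] := face_uniq kK; have [_ ik' jk'] := face_uniq k'K.
have kNf : k \notin [set i; j; k'].
  by rewrite !inE !negb_or kk' eq_sym ik eq_sym jk.
have k'Nf : k' \notin [set i; j; k].
  by rewrite !inE !negb_or (eq_sym k' k) kk' eq_sym ik' eq_sym jk'.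
case: (H f fK fi fj) => fE; [exists k'|exists k]; rewrite fE; split=> //.
- by apply: contraNneq k'Nf => <-; rewrite !inE eqxx !orbT.
- by apply: contraNneq kNf => <-; rewrite !inE eqxx !orbT.
- by move=> g gK gi gj; case: (H g gK gi gj); [right|left].
Qed.

(** Handshake argument in the link of x: every neighbour u of x lies on two
    faces at x, so the faces of S at x that contain a are even in number. *)
Lemma faces_at_even (S : {set {set 'I_n}}) x a : x != a ->
  (forall g, g \in S -> g \in K /\ x \in g) ->
  (forall u g h, u != a -> u != x -> g \in K -> h \in K ->
     x \in g -> x \in h -> u \in g -> u \in h -> g \in S -> h \in S) ->
  ~~ odd #|[set g in S | a \in g]|.
Proof.
move=> xa SK Su.
pose deg u := #|[set g in S | u \in g]|.
have deg_even u : u != a -> u != x -> ~~ odd (deg u).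
  move=> ua ux; rewrite /deg.
  case: (boolP [exists g in S, u \in g]) => [/existsP[g /andP[gS gu]]|N].
    have [gK gx] := SK _ gS.
    have xu : nbr K x u by apply: face_nbr gK gx gu _; rewrite eq_sym.
    rewrite (_ : [set _ in _ | _] = [set f in K | (x \in f) && (u \in f)]).
      by rewrite card_faces_edge.
    apply/setP => h; rewrite !inE; apply/andP/and3P => [[hS hu]|[hK hx hu]].
      by have [hK hx] := SK _ hS.
    by split=> //; apply: (Su u g h).
  rewrite (_ : [set _ in _ | _] = finset.set0) ?cards0 //.
  apply/setP => h; rewrite !inE; apply/negP => /andP[hS hu].
  by case/negP: N; apply/existsP; exists h; rewrite hS hu.
have sum_deg : (\sum_(u | u != x) deg u = #|S| * 2)%N.
  under eq_bigr do rewrite /deg -sum1_card big_mkcond /=.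
  rewrite exchange_big /= -sum_nat_const [RHS]big_mkcond /=.
  apply: eq_bigr => g _; case: ifP => gS; last first.
    by rewrite big1 // => u _; rewrite inE gS.
  have [gK gx] := SK _ gS.
  have := poly_triangle K_poly gK; rewrite (cardsD1 x) gx add1n => -[<-].
  rewrite -sum1_card [LHS]big_mkcond [RHS]big_mkcond /=.
  by apply: eq_bigr => u _; rewrite !inE gS; case: (u != x).
have := congr1 odd sum_deg; rewrite oddM andbF.
rewrite (bigD1 a) /= ?oddD; last by rewrite eq_sym.
rewrite -/(deg a) => /negbT.
rewrite (_ : odd (\sum_(i | _) _) = false) ?addbF //.
elim/big_ind: _ => [//|s t os ot|u /andP[ux ua]]; first by rewrite oddD os ot.
by apply/negbTE/deg_even.
Qed.

(** The faces around x form a cycle: they stay connected through their common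
    edges when the crossings of a single edge xa are disregarded. *)
Lemma link_minus_vertex (S : {set {set 'I_n}}) x a :
  (forall g, g \in S -> g \in K /\ x \in g) ->
  (forall u g h, u != a -> u != x -> g \in K -> h \in K ->
     x \in g -> x \in h -> u \in g -> u \in h -> g \in S -> h \in S) ->
  forall g h, g \in K -> h \in K -> x \in g -> x \in h -> g \in S -> h \in S.
Proof.
move=> SK Su.
have Sall u g h : u != x -> g \in K -> h \in K ->
    x \in g -> x \in h -> u \in g -> u \in h -> g \in S -> h \in S.
  move=> ux gK hK gx hx gu hu gS.
  have [ua|ua] := eqVneq u a; last exact: (Su u g).
  subst a; have xu : x != u by rewrite eq_sym.
  apply: contraNT (faces_at_even xu SK Su) => hS.
  rewrite (_ : [set _ in _ | _] = [set g]) ?cards1 //.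
  apply/setP => f; rewrite !inE; apply/andP/eqP => [[fS fu]|->//].
  have [fK fx] := SK _ fS.
  have [k [kK kg gk H]] := other_face gK gx gu xu.
  have [//|fE] := H f fK fx fu.
  case: (H h hK hx hu) => hE; first by rewrite hE gS in hS.
  by rewrite hE -fE fS in hS.
move=> g h gK hK gx hx gS.
have := poly_link K_poly gK hK gx hx.
move=> /connectP[s gs ->]; elim: s g gK gx gS gs {hK hx h} => [//|h s IHs] g.
move=> gK gx gS /= /andP[/and5P[_ hK _ hx gh2] hs].
have /card_gt0P[u] : (0 < #|(g :&: h) :\ x|)%N.
  by move: gh2; rewrite (cardsD1 x) !inE gx hx; case: #|_|.
rewrite !inE => /and3P[ux gu hu].
by apply: (IHs h hK hx _ hs); apply: (Sall u g).
Qed.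

Lemma connected_closed (D : pred 'I_n) :
  (forall u w, D u -> nbr K u w -> D w) -> forall u w, D u -> D w.
Proof.
move=> Dnbr u w Du; have /connectP[s us ->] := poly_connected K_poly u w.
elim: s u Du us => [//|y s IHs] u Du /= /andP[uy ys].
exact: IHs (Dnbr u y Du uy) ys.
Qed.

(** The link of a vertex x of f, cut at its edge in f, is a path all of whose
    inner vertices avoid f: the faces at x reach one colour only. The three
    vertices of f agree on that colour through the faces next to f, and the
    other colour cannot communicate with f. *)
Lemma face_complement_connected f (P : pred 'I_n) : f \in K ->
  (forall i j, i \notin f -> j \notin f -> nbr K i j -> P i = P j) ->
  forall i j, i \notin f -> j \notin f -> P i = P j.
Proof.
move=> fK Pnbr.
pose meets c x :=
  [set g in K | (x \in g) && [exists i in g, (i \notin f) && (P i == c)]].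
(* a face next to f along xy fixes the colour reached by all the faces at x *)
have meets_link c x y k : x \in f -> y \in f -> x != y ->
    [set x; y; k] \in K -> k \notin f -> P k = ~~ c -> meets c x = finset.set0.
  move=> fx fy xy gK kf Pk.
  have [z [fE zx zy]] := face_third fK fx fy xy.
  have fNm : f \notin meets c x.
    rewrite inE fK fx /=; apply/existsP => -[i /and3P[fi]].
    by rewrite fi.
  apply/setP => g; rewrite [RHS]inE; apply: contraNF fNm => gm.
  have [gK' gx] : g \in K /\ x \in g by move: gm; rewrite inE => /and3P[].
  apply: (@link_minus_vertex _ x z _ _ g f) => //.
    by move=> g'; rewrite inE => /and3P[].
  move=> u g1 g2 uz ux g1K g2K g1x g2x g1u g2u.
  rewrite !inE g1K g2K g1x g2x /= => /existsP[i /and3P[g1i fi /eqP Pi]].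
  have [fu|fu] := boolP (u \in f); last first.
    apply/existsP; exists u; rewrite g2u fu /=; rewrite -Pi.
    have [->//|iu] := eqVneq i u.
    by rewrite (Pnbr u i) // nbrC; apply: (face_nbr g1K).
  have uy : u = y.
    by move: fu; rewrite fE !inE (negPf ux) (negPf uz) orbF => /eqP.
  have [k' [k'K k'f _ H]] := other_face fK fx fy xy.
  have gE : [set x; y; k] = [set x; y; k'].
    case: (H _ gK); rewrite ?inE ?eqxx ?orbT // => E.
    by rewrite -E !inE eqxx !orbT in kf.
  rewrite uy in g1u g2u; exfalso.
  case: (H _ g1K g1x g1u) => g1E; first by rewrite -g1E g1i in fi.
  move: g1i; rewrite g1E -gE !inE.
  move=> /orP[/orP[]|] /eqP iE; move: fi Pi; rewrite iE ?fx ?fy //.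
  by move=> _; rewrite Pk; case: (c).
have [x [y [z [fE xy xz yz]]]] := face_vertices fK.
have fx : x \in f by rewrite fE !inE eqxx.
have fy : y \in f by rewrite fE !inE eqxx orbT.
have fz : z \in f by rewrite fE !inE eqxx !orbT.
have [k [kK kf _ _]] := other_face fK fx fy xy.
suff Pk i : i \notin f -> P i = P k by move=> i j fi fj; rewrite (Pk i) // (Pk j).
move=> fi; apply/eqP/negPn/negP => Pik.
set c := P i in Pik.
have Pkc : P k = ~~ c by move: Pik; rewrite -/c; case: (c); case: (P k).
have mx : meets c x = finset.set0 by apply: (meets_link c x y k).
have my : meets c y = finset.set0.
  by apply: (meets_link c y x k); rewrite // 1?eq_sym // (finset.setUC [set y]).
have [l [lK lf _ _]] := other_face fK fx fz xz.
have Plc : P l = ~~ c.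
  have : [set x; z; l] \notin meets c x by rewrite mx inE.
  rewrite inE lK !inE eqxx /=.
  case: (eqVneq (P l) c) => [Pl|]; last by case: (P l); case: (c).
  by case/existsP; exists l; rewrite !inE eqxx !orbT lf Pl /=.
have mz : meets c z = finset.set0.
  by apply: (meets_link c z x l); rewrite // 1?eq_sym // (finset.setUC [set z]).
have mf u : u \in f -> meets c u = finset.set0.
  by rewrite fE !inE => /orP[/orP[]|] /eqP ->.
have D u w : (u \notin f) && (P u == c) -> nbr K u w ->
    (w \notin f) && (P w == c).
  move=> /andP[fu /eqP Pu] uw.
  have fw : w \notin f.
    apply/negP => fw; have := mf w fw.
    case/nbrP: uw => uw [g [gK gu gw]] /setP/(_ g); rewrite !inE gK gw /=.
    by case/existsP; exists u; rewrite gu fu Pu /=.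
  by rewrite fw -(Pnbr _ _ fu fw uw) Pu /=.
have: (x \notin f) && (P x == c); last by rewrite fx.
by apply: (connected_closed D (u := i)); rewrite fi eqxx.
Qed.

End ClosedSurfaces.

(** * Support planes of a convex surface *)

Section SupportPlanes.

Variables (R : realType) (n : nat) (p : 'I_n -> 'rV[R]_3).
Variable F : {set {set 'I_n}}.
Hypothesis F_poly : polyhedron p F.
Hypothesis F_convex : strongly_strictly_convex p F.

Local Open Scope set_scope.

Implicit Types (i j k l x y z a : 'I_n) (f g : {set 'I_n}).

Lemma convex_comb_lt (t A B C : R) : 0 <= t -> t <= 1 -> A < C -> B < C ->
  t * A + (1 - t) * B < C.
Proof.
rewrite le_eqVlt => /predU1P[<-|t0] t1 AC BC.
  by rewrite subr0 mul0r mul1r add0r.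
have := mulr_gt0 t0 (_ : 0 < C - A).
rewrite subr_gt0 => /(_ AC).
have := mulr_ge0 (_ : 0 <= 1 - t) (_ : 0 <= C - B).
by rewrite !subr_ge0 => /(_ t1 (ltW BC)); lra.
Qed.

Lemma big_set3 (V : nmodType) (G : 'I_n -> V) x y z :
  x != y -> x != z -> y != z ->
  \sum_(i in [set x; y; z]) G i = G x + G y + G z.
Proof.
move=> xy xz yz; rewrite -finset.setUA big_setU1 /=; last first.
  by rewrite !inE negb_or xy xz.
by rewrite big_setU1 ?inE // big_set1 addrA.
Qed.

Lemma affine_independent3 x y z (al be ga : R) : [set x; y; z] \in F ->
  al + be + ga = 0 -> al *: p x + be *: p y + ga *: p z = 0 ->
  [/\ al = 0, be = 0 & ga = 0].
Proof.
move=> fF s0 c0; have [xy xz yz] := face_uniq F_poly fF.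
pose w k := if k == x then al else if k == y then be else ga.
have wx : w x = al by rewrite /w eqxx.
have wy : w y = be by rewrite /w eqxx eq_sym (negPf xy).
have wz : w z = ga by rewrite /w !(eq_sym z) (negPf xz) (negPf yz).
have := poly_nondegenerate F_poly fF (w := w).
rewrite !big_set3 // wx wy wz => /(_ s0 c0) w0.
split; [rewrite -wx|rewrite -wy|rewrite -wz];
  by apply: w0; rewrite !inE eqxx ?orbT.
Qed.

Lemma cell_vertex f i : i \in f -> cell p f (p i).
Proof.
move=> fi; exists (fun k => (k == i)%:R); split.
- by move=> k _; rewrite ler0n.
- rewrite (bigD1 i) //= eqxx big1 ?addr0 // => k /andP[_ /negPf ->] //.
- rewrite (bigD1 i) //= eqxx scale1r big1 ?addr0 // => k /andP[_ /negPf ->].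
  by rewrite scale0r.
Qed.

Lemma vertex_on_surface i : surface p F (p i).
Proof.
by have [f fF fi] := poly_vertex F_poly i; exists f => //; apply: cell_vertex.
Qed.

(** Barycentric coordinates in g are unique, and by embeddedness a point shared
    with f has some that are carried by the common vertices of f and g. *)
Lemma face_weights f g (w : 'I_n -> R) : f \in F -> g \in F ->
  (forall k, k \in g -> 0 <= w k) -> \sum_(k in g) w k = 1 ->
  cell p f (\sum_(k in g) w k *: p k) ->
  forall k, k \in g -> k \notin f -> w k = 0.
Proof.
move=> fF gF w_ge0 w1 fq k gk fk.
have : cell p (f :&: g) (\sum_(k in g) w k *: p k).
  by rewrite -(poly_embedded F_poly) //; split=> //; exists w; split.
case=> w' [_ w'1 w'q].
pose d l := w l - (if l \in f then w' l else 0).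
have fgE (V : nmodType) (G : 'I_n -> V) :
    \sum_(l in f :&: g) G l = \sum_(l in g) (if l \in f then G l else 0).
  rewrite -big_mkcondr; apply: eq_bigl => l; by rewrite inE andbC.
have := poly_nondegenerate F_poly gF (w := d).
rewrite sumrB w1 -fgE w'1 subrr => /(_ erefl).
under eq_bigr do rewrite scalerBl.
rewrite sumrB [X in _ - X](_ : _ = \sum_(l in f :&: g) w' l *: p l); last first.
  by rewrite fgE; apply: eq_bigr => l _; case: ifP => _; rewrite ?scale0r.
rewrite -w'q subrr => /(_ erefl k gk).
by rewrite /d (negPf fk) subr0.
Qed.

Lemma vertex_inj i j : p i = p j -> i = j.
Proof.
move=> pij; apply/eqP/negPn/negP => ij.
have [g gF gi] := poly_vertex F_poly i.
have [f fF fj] := poly_vertex F_poly j.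
have fi : i \in f.
  apply: contraTT isT => fi.
  have sumE (V : lmodType R) (G : 'I_n -> V) :
      \sum_(k in g) (k == i)%:R *: G k = G i.
    rewrite (bigD1 i) //= eqxx scale1r big1 ?addr0 // => k /andP[_ /negPf ->].
    by rewrite scale0r.
  have := @face_weights f g (fun k => (k == i)%:R) fF gF _ _ _ i gi fi.
  rewrite eqxx sumE pij => H; suff: (1 : R) = 0 by move/eqP; rewrite oner_eq0.
  apply: H; [by move=> k _; rewrite ler0n| |exact: cell_vertex].
  have := sumE R^o (fun=> 1).
  by under eq_bigr do rewrite /GRing.scale /= mulr1.
have [k [fE ki kj]] := face_third F_poly fF fi fj ij.
rewrite fE in fF.
have [] := @affine_independent3 i j k 1 (-1) 0 fF; first by rewrite subrr add0r.
  by rewrite pij scale0r addr0 scaleN1r scale1r subrr.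
by move=> /eqP; rewrite oner_eq0.
Qed.

Lemma vertex_support i :
  exists u, forall k, k != i -> dot u (p k) < dot u (p i).
Proof.
have [u [c [_ Sc Sic]]] := F_convex.1 i.
have ui : dot u (p i) = c.
  have : [set p i]%classic (p i) by [].
  by rewrite -Sic => -[].
exists u => k ki; rewrite lt_neqAle ui.
have -> /= : dot u (p k) <= c by apply: (Sc _ (vertex_on_surface k)).
rewrite andbT; apply: contra ki => /eqP uk; apply/eqP/vertex_inj.
suff : [set p i]%classic (p k) by [].
by rewrite -Sic; split=> //; apply: vertex_on_surface.
Qed.

(** The points of the support plane lie on the segment from i to j, and the
    support plane at a vertex excludes the other vertices from that segment. *)
Lemma edge_support i j : nbr F i j -> exists u,
  dot u (p i) = dot u (p j) /\
  forall k, k != i -> k != j -> dot u (p k) < dot u (p i).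
Proof.
move=> ij; have [u [c [_ Sc Sic]]] := F_convex.2 _ ij.
have ue k : k \in [set i; j] -> dot u (p k) = c.
  by move=> /cell_vertex; rewrite -Sic => -[].
have ui := ue i (set21 _ _); have uj := ue j (set22 _ _).
exists u; split; first by rewrite ui uj.
move=> k ki kj; rewrite lt_neqAle ui.
have -> /= : dot u (p k) <= c by apply: (Sc _ (vertex_on_surface k)).
rewrite andbT; apply/negP => /eqP uk.
have : cell p [set i; j] (p k).
  by rewrite -Sic; split=> //; apply: vertex_on_surface.
case=> w [w_ge0 w1 kE]; have [L Lk] := vertex_support k.
have gap l : l \in [set i; j] -> 0 < dot L (p k) - dot L (p l).
  move=> el; rewrite subr_gt0; apply: Lk.
  by move: el; rewrite !inE => /orP[] /eqP ->; rewrite eq_sym.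
have : \sum_(l in [set i; j]) w l * (dot L (p k) - dot L (p l)) = 0.
  under eq_bigr do rewrite mulrBr.
  rewrite sumrB -mulr_suml w1 mul1r {1}kE dot_sumr.
  by under [X in _ - X]eq_bigr do rewrite -dotZr; rewrite subrr.
move=> /psumr_eq0P s0.
have w0 l : l \in [set i; j] -> w l = 0.
  move=> el.
  have /eqP := s0 (fun l el => mulr_ge0 (w_ge0 l el) (ltW (gap l el))) l el.
  by rewrite mulf_eq0 [X in _ || X]gt_eqF ?gap // orbF => /eqP.
by move: w1; rewrite big1 // => /eqP; rewrite eq_sym oner_eq0.
Qed.

Lemma face_cross_neq0 x y z : [set x; y; z] \in F ->
  cross (p y - p x) (p z - p x) != 0.
Proof.
move=> fF; set e := p y - p x; set e' := p z - p x; apply/eqP => nn0.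
have E0 : dot e e *: e' - dot e e' *: e = 0.
  transitivity (cross (cross e e') e); first by row_ring.
  by rewrite nn0; row_ring.
have [||_ _ ee0] :=
    @affine_independent3 x y z (dot e e' - dot e e) (- dot e e') (dot e e) fF.
- by ring.
- by rewrite -E0; move: (dot e e) (dot e e') => r r'; rewrite /e /e'; row_ring.
- have [xy _ _] := face_uniq F_poly fF.
  move/dot_eq0/eqP: ee0; rewrite /e subr_eq0 => /eqP/vertex_inj yx.
  by rewrite yx eqxx in xy.
Qed.

Lemma plane_barycentric x y z (q : 'rV[R]_3) : [set x; y; z] \in F ->
  dot (q - p x) (cross (p y - p x) (p z - p x)) = 0 ->
  exists al be ga, al + be + ga = 1 /\ q = al *: p x + be *: p y + ga *: p z.
Proof.
move=> fF qn.
set e := p y - p x in qn *; set e' := p z - p x in qn *.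
set nn := cross e e' in qn *.
have nn0 : dot nn nn != 0 by rewrite gt_eqF // dot_gt0 // face_cross_neq0.
pose be := dot (cross (q - p x) e') nn / dot nn nn.
pose ga := dot (cross e (q - p x)) nn / dot nn nn.
exists (1 - be - ga), be, ga; split; first by ring.
suff -> : q = p x + be *: e + ga *: e' by rewrite /e /e'; row_ring.
apply: (@scalerI _ _ (dot nn nn)) => //.
transitivity (dot nn nn *: p x + dot (cross (q - p x) e') nn *: e
   + dot (cross e (q - p x)) nn *: e').
  transitivity (dot nn nn *: p x + dot (cross (q - p x) e') nn *: e
   + dot (cross e (q - p x)) nn *: e' + dot (q - p x) nn *: nn).
    by rewrite /nn; row_ring.
  by rewrite qn scale0r addr0.
by rewrite !scalerDr !scalerA /be /ga !(mulrC (dot nn nn)) !divfK.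
Qed.

(** In the plane of a face, the support planes at its three edges leave nothing
    of the hull but the face itself. An edge of the surface that crossed this
    plane would thus meet the face, against embeddedness; as the complement of
    the face is connected, all of it is on one side. *)
Lemma face_support f : f \in F -> exists u c,
  (forall i, i \in f -> dot u (p i) = c) /\
  (forall k, k \notin f -> dot u (p k) < c).
Proof.
move=> fF.
have [x [y [z [fE xy xz yz]]]] := face_vertices F_poly fF.
have xyzF : [set x; y; z] \in F by rewrite -fE.
have fx : x \in f by rewrite fE !inE eqxx.
have fy : y \in f by rewrite fE !inE eqxx orbT.
have fz : z \in f by rewrite fE !inE eqxx !orbT.
pose nn := cross (p y - p x) (p z - p x).
pose phi q := dot (q - p x) nn.
have coef_gt0 k l t (q : 'rV[R]_3) : k \notin f -> l \notin f -> 0 <= t -> t <= 1 ->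
    q = t *: p k + (1 - t) *: p l -> phi q = 0 ->
    exists al be ga, [/\ 0 < al, 0 < be, 0 < ga, al + be + ga = 1
      & q = al *: p x + be *: p y + ga *: p z].
  move=> fk fl t0 t1 qE q0.
  have edge i j : i \in f -> j \in f -> i != j -> exists L,
      [/\ dot L (p i) = dot L (p j), dot L q < dot L (p i)
        & forall m, m != i -> m != j -> dot L (p m) < dot L (p i)].
    move=> fi fj ij.
    have [L [Lij Lk]] := edge_support (face_nbr fF fi fj ij).
    have kL : dot L (p k) < dot L (p i).
      by apply: Lk; apply: contraNneq fk => ->.
    have lL : dot L (p l) < dot L (p i).
      by apply: Lk; apply: contraNneq fl => ->.
    by exists L; split=> //; rewrite qE dotDr !dotZr; apply: convex_comb_lt.
  have [al [be [ga [s1 qE']]]] := plane_barycentric xyzF q0.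
  exists al, be, ga; split=> //.
  - have [L [Lyz Lq Lx]] := edge y z fy fz yz.
    have := Lx x xy xz; move: Lq; rewrite qE' !dotDr !dotZr -Lyz.
    have -> : ga = 1 - al - be by rewrite -s1; ring.
    by nra.
  - have [L [Lxz Lq Ly]] := edge x z fx fz xz.
    have yx : y != x by rewrite eq_sym.
    have := Ly y yx yz; move: Lq; rewrite qE' !dotDr !dotZr -Lxz.
    have -> : ga = 1 - al - be by rewrite -s1; ring.
    by nra.
  - have [L [Lxy Lq Lz]] := edge x y fx fy xy.
    have zx : z != x by rewrite eq_sym.
    have zy : z != y by rewrite eq_sym.
    have := Lz z zx zy; move: Lq; rewrite qE' !dotDr !dotZr -Lxy.
    have -> : al = 1 - be - ga by rewrite -s1; ring.
    by nra.
have off k : k \notin f -> phi (p k) != 0.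
  move=> fk; apply/eqP => k0.
  have [|al [be [ga [al0 be0 ga0 s1 kE]]]] :=
    coef_gt0 k k 1 (p k) fk fk ler01 (lexx _) _ k0.
    by rewrite subrr scale0r addr0 scale1r.
  have [L Lk] := vertex_support k.
  have kx : dot L (p x) < dot L (p k) by apply: Lk; apply: contraNneq fk => <-.
  have ky : dot L (p y) < dot L (p k) by apply: Lk; apply: contraNneq fk => <-.
  have kz : dot L (p z) < dot L (p k) by apply: Lk; apply: contraNneq fk => <-.
  have := congr1 (dot L) kE; rewrite !dotDr !dotZr.
  have -> : al = 1 - be - ga by rewrite -s1; ring.
  have : 0 < 1 - be - ga by rewrite -s1; lra.
  by nra.
have cross_free k l : k \notin f -> l \notin f -> nbr F k l ->
    0 < phi (p k) -> phi (p l) < 0 -> False.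
  move=> fk fl kl k0 l0; have kl0 : 0 < phi (p k) - phi (p l) by lra.
  pose t := - phi (p l) / (phi (p k) - phi (p l)).
  have tE : t * (phi (p k) - phi (p l)) = - phi (p l) by rewrite divfK ?gt_eqF.
  have t0 : 0 < t by rewrite divr_gt0 // oppr_gt0.
  have t1 : t <= 1 by rewrite ler_pdivrMr // mul1r; lra.
  pose q := t *: p k + (1 - t) *: p l.
  have q0 : phi q = 0.
    transitivity (t * (phi (p k) - phi (p l)) + phi (p l)); last by rewrite tE addNr.
    by rewrite /phi /q !(dotBl, dotDl, dotZl); ring.
  have [al [be [ga [al0 be0 ga0 s1 qE]]]] :=
    coef_gt0 k l t q fk fl (ltW t0) t1 erefl q0.
  have fq : cell p f q.
    pose w m := if m == x then al else if m == y then be else ga.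
    have wx : w x = al by rewrite /w eqxx.
    have wy : w y = be by rewrite /w eqxx eq_sym (negPf xy).
    have wz : w z = ga by rewrite /w !(eq_sym z) (negPf xz) (negPf yz).
    exists w; rewrite fE !big_set3 // wx wy wz; split=> // m _.
    by rewrite /w; do 2?case: ifP => _; apply: ltW.
  have [klN [g [gF gk gl]]] := nbrP _ _ _ kl.
  have [m [gE mk ml]] := face_third F_poly gF gk gl klN.
  pose w i := if i == k then t else if i == l then 1 - t else 0.
  have wk : w k = t by rewrite /w eqxx.
  have wl : w l = 1 - t by rewrite /w eqxx eq_sym (negPf klN).
  have wm : w m = 0 by rewrite /w (negPf mk) (negPf ml).
  have km : k != m by rewrite eq_sym.
  have lm : l != m by rewrite eq_sym.
  have := @face_weights f g w fF gF _ _ _ k gk fk; rewrite wk => H.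
  suff : t = 0 by move=> tz; rewrite tz ltxx in t0.
  apply: H.
  - by move=> i _; rewrite /w; do 2?case: ifP => _; lra.
  - by rewrite gE big_set3 // wk wl wm; ring.
  - by rewrite gE big_set3 // wk wl wm scale0r addr0.
have sideE k l : k \notin f -> l \notin f -> (0 < phi (p k)) = (0 < phi (p l)).
  apply: (face_complement_connected F_poly (P := fun k => 0 < phi (p k)) fF).
  move=> {}k {}l fk fl kl; have := off k fk; have := off l fl.
  move=> /eqP l_off /eqP k_off.
  have [k0|k0|/esym k0] := ltgtP 0 (phi (p k));
    have [l0|l0|/esym l0] := ltgtP 0 (phi (p l)) => //.
    by case: (cross_free k l fk fl kl).
  by case: (cross_free l k fl fk _ l0 k0); rewrite nbrC.
have phif i : i \in f -> phi (p i) = 0.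
  by rewrite fE !inE => /orP[/orP[]|] /eqP ->; rewrite /phi /nn; vec_ring.
have phiE i : dot nn (p i) = phi (p i) + dot nn (p x).
  by rewrite /phi; vec_ring.
have [/existsP[k /andP[fk k0]]|] :=
    boolP [exists k, (k \notin f) && (0 < phi (p k))].
  exists (- nn), (- dot nn (p x)); split=> i fi; rewrite dotNl phiE.
    by rewrite phif // add0r.
  by rewrite ltrN2 ltrDr -(sideE k).
move=> N; exists nn, (dot nn (p x)); split=> i fi; rewrite phiE.
  by rewrite phif // add0r.
rewrite -[ltRHS]add0r ltrD2r lt_neqAle off //= leNgt; apply: contra N => i0.
by apply/existsP; exists i; rewrite fi.
Qed.

(** With a as origin, the planes of the faces that avoid a are all written as
    level 1 of a linear form, so that the forms of two adjacent faces agree on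
    their common edge. *)
Lemma face_normal a f : f \in F -> a \notin f -> exists N,
  (forall i, i \in f -> dot N (p i - p a) = 1) /\
  (forall k, k \notin f -> dot N (p k - p a) < 1).
Proof.
move=> fF fa; have [u [c [uf uNf]]] := face_support fF.
have ca : 0 < c - dot u (p a) by rewrite subr_gt0 uNf.
exists ((c - dot u (p a))^-1 *: u); split=> i fi; rewrite dotZl dotBr.
  by rewrite (uf i fi) mulVf // gt_eqF.
by rewrite mulrC ltr_pdivrMr // mul1r ltrD2r uNf.
Qed.

Lemma face_det a x y z : [set x; y; z] \in F -> a \notin [set x; y; z] ->
  det3 (p x - p a) (p y - p a) (p z - p a) != 0.
Proof.
move=> fF fa; have [N [Nf _]] := face_normal fF fa.
have [xy xz yz] := face_uniq F_poly fF.
have Nx : dot N (p x - p a) = 1 by rewrite Nf // !inE eqxx.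
have Ny : dot N (p y - p a) = 1 by rewrite Nf // !inE eqxx orbT.
have Nz : dot N (p z - p a) = 1 by rewrite Nf // !inE eqxx !orbT.
apply/eqP => D0.
set X := p x - p a in Nx D0; set Y := p y - p a in Ny D0.
set Z := p z - p a in Nz D0.
(* by Cramer's rule each coordinate k of these cross products gives a linear
   relation between X, Y and Z, hence an affine relation as N = 1 on them *)
have rel (k : 'I_3) : cross X Y 0 k = 0.
  have lin : cross Y Z 0 k *: X + cross Z X 0 k *: Y + cross X Y 0 k *: Z = 0.
    suff -> : cross Y Z 0 k *: X + cross Z X 0 k *: Y + cross X Y 0 k *: Z =
        det3 X Y Z *: (\row_l (l == k)%:R) by rewrite D0 scale0r.
    have dlt (l m : 'I_3) : (\row_l0 (l0 == m)%:R : 'rV[R]_3) 0 l = (l == m)%:R.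
      by rewrite mxE.
    have [->|[->|->]] : k = ax0 \/ k = ax1 \/ k = ax2.
      case: k => -[|[|[|//]]] k3; [left|right; left|right; right]; exact: val_inj.
    - by apply: row3P; rewrite /det3 !scalevE !coordE dlt /=; ring.
    - by apply: row3P; rewrite /det3 !scalevE !coordE dlt /=; ring.
    - by apply: row3P; rewrite /det3 !scalevE !coordE dlt /=; ring.
  have s0 : cross Y Z 0 k + cross Z X 0 k + cross X Y 0 k = 0.
    have := congr1 (dot N) lin.
    by rewrite !dotDr !dotZr Nx Ny Nz !mulr1 dot0r.
  have [//|_ _ ->//] := affine_independent3 fF s0.
  transitivity (cross Y Z 0 k *: X + cross Z X 0 k *: Y + cross X Y 0 k *: Z
     + (cross Y Z 0 k + cross Z X 0 k + cross X Y 0 k) *: p a).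
    rewrite /X /Y /Z.
    move: (cross _ _ _ _) (cross _ _ _ _) (cross _ _ _ _) => r1 r2 r3.
    by row_ring.
  by rewrite lin s0 scale0r addr0.
have XY : X = Y.
  apply/eqP; rewrite -subr_eq0; apply/eqP.
  transitivity (cross N (cross X Y)).
    transitivity (dot N Y *: X - dot N X *: Y); first by rewrite Nx Ny !scale1r.
    by row_ring.
  have -> : cross X Y = 0 by apply: row3P; rewrite rel zerovE.
  by row_ring.
by move/addIr: XY => /vertex_inj xyE; rewrite xyE eqxx in xy.
Qed.

End SupportPlanes.

(** * Infinitesimal flexes seen from a vertex *)

Section CapFlexes.

Variables (R : realType) (n : nat) (p : 'I_n -> 'rV[R]_3).
Variable F : {set {set 'I_n}}.
Hypothesis F_poly : polyhedron p F.
Hypothesis F_convex : strongly_strictly_convex p F.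
Variable a : 'I_n.

Local Open Scope set_scope.

Implicit Types (i j k l b c d : 'I_n) (f g : {set 'I_n}).
Implicit Types (v : 'I_n -> 'rV[R]_3).

Definition ray i : 'rV[R]_3 := p i - p a.

(** The cap at a consists of the faces that avoid a. *)
Definition cap_flex v : Prop := forall f i j,
  f \in F -> a \notin f -> i \in f -> j \in f ->
  dot (p i - p j) (v i - v j) = 0.

(** Half the rate of change of the squared distance to a fixed origin a. *)
Definition radial v i : R := dot (ray i) (v i).

Lemma rayB i j : ray i - ray j = p i - p j.
Proof. by rewrite /ray; row_ring. Qed.

Lemma cap_flex_sub_motion v (tau rho : 'rV[R]_3) : cap_flex v ->
  cap_flex (fun i => v i - (tau + cross rho (ray i))).
Proof.
move=> v_flex f i j fF fa fi fj; rewrite -[RHS](v_flex f i j fF fa fi fj).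
transitivity (dot (p i - p j) (v i - v j)
  - dot (p i - p j) (cross rho (ray i - ray j))); first by vec_ring.
by rewrite rayB; vec_ring.
Qed.

Lemma radial_sub_motion v (tau rho : 'rV[R]_3) i :
  radial (fun i => v i - (tau + cross rho (ray i))) i =
  radial v i - dot tau (ray i).
Proof. by rewrite /radial; vec_ring. Qed.

(** In a face ijk of the cap, turning with angular velocity rho and lying in the
    plane of the normal form N, the summand is rho . N up to the orientation of
    the triangle. *)
Definition flux v i j : R :=
  \sum_(k | ([set i; j; k] \in F) && (a \notin [set i; j; k]))
    dot (v j - v i) (p k - p i) / `|det3 (ray i) (ray j) (ray k)|.

(** Each face at i contributes twice, with opposite orientations. *)
Lemma sum_flux v i : cap_flex v -> \sum_j flux v i j = 0.
Proof.
move=> v_flex; rewrite /flux.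
under eq_bigr do rewrite big_mkcond.
pose q j k := if ([set i; j; k] \in F) && (a \notin [set i; j; k]) then
  dot (v j - v i) (p k - p i) / `|det3 (ray i) (ray j) (ray k)| else 0.
rewrite -[LHS]/(\sum_j \sum_k q j k).
suff S : \sum_j \sum_k q j k = - (\sum_j \sum_k q j k).
  by move: S => /= S; lra.
rewrite {1}exchange_big /= -sumrN; apply: eq_bigr => j _.
rewrite -sumrN; apply: eq_bigr => k _.
rewrite /q (finset.setUAC [set i] [set k]); case: ifP => [|_]; last by rewrite oppr0.
move=> /andP[fF fa].
have fi : i \in [set i; j; k] by rewrite !inE eqxx.
have fj : j \in [set i; j; k] by rewrite !inE eqxx orbT.
have fk : k \in [set i; j; k] by rewrite !inE eqxx orbT.
have := v_flex _ _ _ fF fa fi fj; have := v_flex _ _ _ fF fa fi fk.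
have := v_flex _ _ _ fF fa fj fk => jk ik ij.
rewrite (_ : det3 (ray i) (ray k) (ray j) = - det3 (ray i) (ray j) (ray k)).
  rewrite normrN -mulNr; congr (_ / _).
  transitivity (- dot (v j - v i) (p k - p i) + dot (p i - p j) (v i - v j)
    + dot (p i - p k) (v i - v k) - dot (p j - p k) (v j - v k)).
    by vec_ring.
  by rewrite jk ik ij; ring.
by vec_ring.
Qed.

(** The triangles X Y Z and X Y Z' form a convex roof above the origin along the
    edge XY, so they lie on opposite sides of the plane of X and Y. By Cramer's
    rule the left-hand side is a multiple of w . Y; the factor m is the length of
    N - N' in units of that of the vector product of X and Y. *)
Lemma convex_roof (X Y Z Z' N N' : 'rV[R]_3) :
  dot N X = 1 -> dot N Y = 1 -> dot N Z = 1 -> dot N Z' < 1 ->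
  dot N' X = 1 -> dot N' Y = 1 -> dot N' Z' = 1 -> dot N' Z < 1 ->
  det3 X Y Z != 0 -> det3 X Y Z' != 0 ->
  exists2 m, 0 < m & forall w, dot w X = dot w Y ->
    dot w (Z - X) / `|det3 X Y Z| + dot w (Z' - X) / `|det3 X Y Z'|
      = - m * dot w Y.
Proof.
move=> NX NY NZ NZ' N'X N'Y N'Z' N'Z D0 D'0.
set D := det3 X Y Z in D0 *; set D' := det3 X Y Z' in D'0 *.
have cramer u : D * dot u Z' =
    D' * dot u Z + det3 Z' Y Z * dot u X + det3 X Z' Z * dot u Y.
  by rewrite /D /D'; vec_ring.
have opp : D * (dot N Z' - 1) = D' * (1 - dot N' Z).
  have := cramer N; have := cramer N'.
  by rewrite NX NY NZ N'X N'Y N'Z' !mulr1; lra.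
have normD' : `|D'| / D' = - (`|D| / D).
  have nz : (0 < dot N Z' - 1) = false by apply/negbTE; rewrite -leNgt; lra.
  have [D_gt0|D_lt0|D_eq0] := ltgtP 0 D; last by rewrite -D_eq0 eqxx in D0.
    have D'_lt0 : D' < 0 by nra.
    by rewrite (gtr0_norm D_gt0) (ltr0_norm D'_lt0) mulNr !divff.
  have D'_gt0 : 0 < D' by nra.
  by rewrite (ltr0_norm D_lt0) (gtr0_norm D'_gt0) mulNr opprK !divff.
exists ((1 - dot N Z') / `|D'|).
  by rewrite divr_gt0 ?subr_gt0 // normr_gt0.
move=> w wXY.
have nD0 : `|D| != 0 by rewrite normr_eq0.
have nD'0 : `|D'| != 0 by rewrite normr_eq0.
have absE : D' / `|D'| = - (D / `|D|).
  apply: invr_inj; rewrite invrN !invf_div; exact: normD'.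
have wZ' : dot w (Z' - X) = (dot N Z' - 1) * dot w Y + D' / D * dot w (Z - X).
  apply: (mulfI D0); have := cramer N; have := cramer w.
  rewrite !dotBr NX NY NZ wXY !mulr1 => cw cN.
  have -> : D * ((dot N Z' - 1) * dot w Y + D' / D * (dot w Z - dot w Y))
    = D * (dot N Z' - 1) * dot w Y + D' * (dot w Z - dot w Y) by field.
  rewrite !mulrBr cw cN; ring.
rewrite wZ'.
transitivity (dot w (Z - X) / `|D| + (dot N Z' - 1) * dot w Y / `|D'|
  + (D' / `|D'|) / D * dot w (Z - X)).
  by field; rewrite D0 nD0 nD'0.
rewrite absE; field; by rewrite D0 nD0 nD'0.
Qed.

Lemma flux_edge i j : nbr F i j ->
  (forall f, f \in F -> i \in f -> j \in f -> a \notin f) ->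
  exists2 m, 0 < m & forall v, cap_flex v ->
    flux v i j = - m * dot (v j - v i) (ray j).
Proof.
move=> ij ijNa; have [k [k' [kk' fF f'F two]]] := edge_faces F_poly ij.
have [fi fj] : i \in [set i; j; k] /\ j \in [set i; j; k] by rewrite !inE !eqxx orbT.
have [f'i f'j] : i \in [set i; j; k'] /\ j \in [set i; j; k'].
  by rewrite !inE !eqxx orbT.
have fk : k \in [set i; j; k] by rewrite !inE eqxx orbT.
have f'k' : k' \in [set i; j; k'] by rewrite !inE eqxx orbT.
have [_ ik jk] := face_uniq F_poly fF; have [_ ik' jk'] := face_uniq F_poly f'F.
have fa := ijNa _ fF fi fj; have f'a := ijNa _ f'F f'i f'j.
have [N [Nf Nk']] := face_normal F_poly F_convex fF fa.
have [N' [Nf' Nk]] := face_normal F_poly F_convex f'F f'a.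
have fk' : k' \notin [set i; j; k].
  by rewrite !inE !negb_or eq_sym ik' eq_sym jk' eq_sym kk'.
have f'k : k \notin [set i; j; k'].
  by rewrite !inE !negb_or eq_sym ik eq_sym jk kk'.
have [m m0 H] := convex_roof (Nf i fi) (Nf j fj) (Nf k fk) (Nk' k' fk')
  (Nf' i f'i) (Nf' j f'j) (Nf' k' f'k') (Nk k f'k)
  (face_det F_poly F_convex fF fa) (face_det F_poly F_convex f'F f'a).
exists m => // v v_flex; rewrite /flux.
rewrite (eq_bigl (mem [set k; k'])); last first.
  move=> l; rewrite !inE; apply/andP/orP => [[lF la]|].
    have li : i \in [set i; j; l] by rewrite !inE eqxx.
    have lj : j \in [set i; j; l] by rewrite !inE eqxx orbT.
    have ll : l \in [set i; j; l] by rewrite !inE eqxx orbT.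
    have [_ il jl] := face_uniq F_poly lF.
    case: (two _ lF li lj) => E; [left|right]; move: ll; rewrite E !inE;
      by rewrite !(eq_sym l) (negPf il) (negPf jl) /= eq_sym.
  by move=> [] /eqP ->; split=> //; move: fa f'a; rewrite !inE.
rewrite big_setU1 ?inE //= big_set1 -!(rayB k) -!(rayB k').
apply: H; have := v_flex _ _ _ fF fa fi fj.
rewrite -rayB dotBl !(dotC (v j - v i)) => /eqP; rewrite subr_eq0 => /eqP.
by rewrite !dotBr; lra.
Qed.

(** When i is fixed, the radial velocity of each neighbour is its flux over a
    negative weight, and the fluxes add up to zero: this is the mean value
    property of a discrete harmonic function. *)
Lemma radial_spread v i : cap_flex v -> i != a -> v i = 0 ->
  (forall j, nbr F i j -> 0 <= radial v j) ->
  (forall f j, f \in F -> i \in f -> a \in f -> j \in f -> j != a -> v j = 0) ->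
  forall j, nbr F i j -> (forall f, f \in F -> i \in f -> j \in f -> a \notin f) ->
  radial v j = 0.
Proof.
move=> v_flex ia vi0 v_ge0 v0.
have flux_le0 j : flux v i j <= 0.
  have [ij|ijN] := boolP (nbr F i j); last first.
    rewrite /flux big_pred0 // => k; apply/negP => /andP[fF _].
    case/negP: ijN; apply/nbrP; have [ij _ _] := face_uniq F_poly fF.
    by split=> //; exists [set i; j; k]; rewrite fF !inE !eqxx orbT.
  have [/existsP[f /and4P[fF fi fj fa]]|N] :=
      boolP [exists f, [&& f \in F, i \in f, j \in f & a \in f]].
    have [->|ja] := eqVneq j a.
      by rewrite /flux big_pred0 // => k; rewrite !inE eqxx orbT andbF.
    rewrite /flux big1 // => k _; rewrite vi0 (v0 f j) // subrr dot0l mul0r //.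
  have [||m m0 ->//] := @flux_edge i j => //.
    move=> f fF fi fj; apply/negP => fa; case/negP: N.
    by apply/existsP; exists f; rewrite fF fi fj.
  by rewrite vi0 subr0 dotC mulNr oppr_le0 mulr_ge0 ?(ltW m0) //; apply: v_ge0.
move=> j ij ijNa; have [m m0 jE] := flux_edge ij ijNa.
have := sum_flux i v_flex; rewrite -[LHS]opprK -sumrN => /eqP.
rewrite oppr_eq0 psumr_eq0 => [/allP/(_ j (mem_index_enum j))|k _]; last first.
  by rewrite oppr_ge0.
rewrite jE // vi0 subr0 dotC mulNr opprK mulf_eq0 (gt_eqF m0).
by move=> /eqP.
Qed.

Lemma ray_neq0 i : i != a -> ray i != 0.
Proof. 
by apply: contra => /eqP/subr0_eq/(vertex_inj F_poly) ->.
Qed.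

(** Subtracting a rotation about a, which has no radial part, fixes a vertex
    whose radial velocity vanishes. *)
Lemma radial_spread_interior v i : cap_flex v -> i != a -> ~~ nbr F a i ->
  radial v i = 0 -> (forall j, nbr F i j -> 0 <= radial v j) ->
  forall j, nbr F i j -> radial v j = 0.
Proof.
move=> v_flex ia aiN vi v_ge0 j ij.
have i0 : dot (ray i) (ray i) != 0 by rewrite gt_eqF // dot_gt0 // ray_neq0.
pose rho := (dot (ray i) (ray i))^-1 *: cross (ray i) (v i).
pose w k := v k - (0 + cross rho (ray k)).
have wE k : radial w k = radial v k.
  by rewrite radial_sub_motion dot0l subr0.
have iNa f : f \in F -> i \in f -> a \notin f.
  move=> fF fi; apply: contra aiN => fa; rewrite nbrC.
  exact: face_nbr fF fi fa ia.
rewrite -wE; apply: (@radial_spread w i) => //.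
- exact: cap_flex_sub_motion.
- apply/eqP; rewrite /w add0r subr_eq0; apply/eqP.
  apply: (@scalerI _ _ (dot (ray i) (ray i))) => //.
  transitivity (cross (cross (ray i) (v i)) (ray i)).
    transitivity (dot (ray i) (ray i) *: v i - radial v i *: ray i).
      by rewrite vi scale0r subr0.
    by rewrite /radial; row_ring.
  transitivity ((dot (ray i) (ray i) / dot (ray i) (ray i))
      *: cross (cross (ray i) (v i)) (ray i)).
    by rewrite divff // scale1r.
  by rewrite /rho; move: (dot _ _)^-1 => r; row_ring.
- by move=> k ik; rewrite wE v_ge0.
- by move=> f k fF fi fa; case/negP: (iNa f fF fi).
- by move=> f fF fi _; apply: iNa.
Qed.

(** Divide the radial velocities by the values of a support form at a. Where the
    quotient is minimal, subtracting a translation makes it vanish, so a minimum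
    off the link of a spreads to all neighbours, and finally to that link. *)
Lemma radial_min_principle v : cap_flex v ->
  (forall j, nbr F a j -> 0 <= radial v j) ->
  forall j, j != a -> 0 <= radial v j.
Proof.
move=> v_flex v_ge0 j ja; rewrite leNgt; apply/negP => vj.
have [u uP] := vertex_support F_poly F_convex a.
pose h i := - dot u (ray i).
have h_gt0 i : i != a -> 0 < h i.
  by move=> ia; rewrite oppr_gt0 /ray dotBr subr_lt0 uP.
pose zeta i := radial v i / h i.
pose i0 := [arg min_(i < j | i != a) zeta i]%O.
have [i0a i0min] : i0 != a /\ forall i, i != a -> zeta i0 <= zeta i.
  by rewrite /i0; case: arg_minP.
have zeta_lt0 : zeta i0 < 0.
  apply: le_lt_trans (i0min j ja) _.
  by rewrite /zeta pmulr_llt0 // invr_gt0 h_gt0.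
pose w i := v i - (- zeta i0 *: u + cross 0 (ray i)).
have w_flex : cap_flex w by apply: cap_flex_sub_motion.
have wE i : radial w i = radial v i - zeta i0 * h i.
  by rewrite radial_sub_motion dotZl /h; ring.
have w_ge0 i : i != a -> 0 <= radial w i.
  move=> ia; rewrite wE subr_ge0 -ler_pdivlMr ?h_gt0 //; exact: i0min.
have w_gt0 i : nbr F a i -> 0 < radial w i.
  move=> ai; have ia : i != a by rewrite eq_sym (nbr_neq ai).
  have := v_ge0 i ai; have := h_gt0 i ia; rewrite wE => hi vi.
  have : zeta i0 * h i < 0 by rewrite nmulr_rlt0.
  by lra.
pose zero i := (i != a) && (radial w i == 0).
suff : zero a by rewrite /zero eqxx.
apply: (connected_closed F_poly (D := zero) _ (u := i0)) => [i k|].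
  move=> /andP[ia /eqP wi] ik.
  have aiN : ~~ nbr F a i by apply/negP => /w_gt0; rewrite wi ltxx.
  have ka : k != a by apply: contraNneq aiN => <-; rewrite nbrC.
  rewrite /zero ka /=; apply/eqP.
  apply: (radial_spread_interior w_flex ia aiN wi) ik => l il.
  by apply: w_ge0; apply: contraNneq aiN => <-; rewrite nbrC.
by rewrite /zero i0a wE /zeta divfK ?subrr ?eqxx // gt_eqF // h_gt0.
Qed.

End CapFlexes.

(** * Rigid motions of a triangle *)

Section TriangleMotion.

Variable R : realType.
Implicit Types (e f w u : 'rV[R]_3).

Lemma cross_inj2 e f w :
  cross e f != 0 -> cross w e = 0 -> cross w f = 0 -> w = 0.
Proof.
set N := cross e f => N0 we wf.
apply: (@scalerI _ _ (dot N N)); first by rewrite gt_eqF ?dot_gt0.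
transitivity (dot (cross w f) N *: e - dot N (cross w e) *: f
  + dot (cross w e) f *: N); first by rewrite /N; row_ring.
by rewrite we wf !dot0l dot0r; row_ring.
Qed.

Lemma det3_cross_neq0 (x y z : 'rV[R]_3) : det3 x y z != 0 -> cross x y != 0.
Proof.
apply: contra => /eqP xy0; apply/eqP.
by transitivity (dot (cross x y) z); [vec_ring|rewrite xy0 dot0l].
Qed.

Lemma cramer3 (x y z w : 'rV[R]_3) :
  det3 x y z *: w = det3 w y z *: x + det3 x w z *: y + det3 x y w *: z.
Proof. by apply: row3P; rewrite /det3 !coordE; ring. Qed.

Lemma dot_comb3 (r s t : R) (w x y z : 'rV[R]_3) :
  dot w (r *: x + s *: y + t *: z) = r * dot w x + s * dot w y + t * dot w z.
Proof. by rewrite !dotDr !dotZr. Qed.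

Lemma scaler_comb3 (c r s t : R) (x y z : 'rV[R]_3) :
  c *: (r *: x + s *: y + t *: z) = (c * r) *: x + (c * s) *: y + (c * t) *: z.
Proof. by rewrite !scalerDr !scalerA. Qed.

Lemma crossZl (t : R) e f : cross (t *: e) f = t *: cross e f.
Proof. by row_ring. Qed.

(** The coordinates of rho in the frame e, f, N are dictated by the components of
    w and u along N and by w . f; the three relations say that nothing else is
    left to match. *)
Lemma rotation_of_two_vectors e f w u : cross e f != 0 ->
  dot w e = 0 -> dot u f = 0 -> dot w f + dot u e = 0 ->
  exists rho, w = cross rho e /\ u = cross rho f.
Proof.
set N := cross e f => N0 we uf wf.
have NN : dot N N != 0 by rewrite gt_eqF ?dot_gt0.
pose rho := dot u N *: e - dot w N *: f + dot w f *: N.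
exists ((dot N N)^-1 *: rho); rewrite !crossZl.
split; apply: (@scalerI _ _ (dot N N)); rewrite // scalerA divff // scale1r.
- transitivity (cross rho e + dot w e *: cross f N).
    by rewrite /rho /N; row_ring.
  by rewrite we scale0r addr0.
- transitivity (cross rho f + dot u f *: cross N e
    + (dot w f + dot u e) *: cross f N).
    by rewrite /rho /N; row_ring.
  by rewrite uf wf !scale0r !addr0.
Qed.

Lemma triangle_motion (x y z vx vy vz : 'rV[R]_3) :
  cross (y - x) (z - x) != 0 ->
  dot (x - y) (vx - vy) = 0 -> dot (x - z) (vx - vz) = 0 ->
  dot (y - z) (vy - vz) = 0 ->
  exists tau rho, [/\ vx = tau + cross rho x, vy = tau + cross rho y
    & vz = tau + cross rho z].
Proof.
move=> N0 xy xz yz.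
have [||| rho [vyx vzx]] := @rotation_of_two_vectors _ _ (vy - vx) (vz - vx) N0.
- by rewrite -xy; vec_ring.
- by rewrite -xz; vec_ring.
- transitivity (dot (x - y) (vx - vy) + dot (x - z) (vx - vz)
     - dot (y - z) (vy - vz)); first by vec_ring.
  by rewrite xy xz yz; ring.
exists (vx - cross rho x), rho; split.
- by rewrite subrK.
- transitivity (vx + cross rho (y - x)); first by rewrite -vyx addrC subrK.
  by row_ring.
- transitivity (vx + cross rho (z - x)); first by rewrite -vzx addrC subrK.
  by row_ring.
Qed.

End TriangleMotion.

(** * Ears of the link of a vertex *)

Section Ears.

Variables (R : realType) (n : nat) (p : 'I_n -> 'rV[R]_3).
Variable F : {set {set 'I_n}}.
Hypothesis F_poly : polyhedron p F.
Hypothesis F_convex : strongly_strictly_convex p F.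
Variable a : 'I_n.

Local Open Scope set_scope.

Implicit Types (i j k l b c d : 'I_n) (f g : {set 'I_n}).
Implicit Types (v : 'I_n -> 'rV[R]_3).

Local Notation X := (ray p a).
Local Notation rad := (radial p a).
Local Notation cap := (cap_flex p F a).

(** In the link of a the vertices c, b, d are consecutive, and denting at the edge
    ab removes the tip b from that link. *)
Definition is_ear b c d : bool :=
  [&& c != d, [set a; b; c] \in F & [set a; b; d] \in F].

Lemma is_earC b c d : is_ear b c d = is_ear b d c.
Proof. by rewrite /is_ear eq_sym [X in _ && X]andbC. Qed.

Lemma ear_uniq b c d : is_ear b c d ->
  [/\ b != a, c != a, d != a, b != c & b != d /\ c != d].
Proof.
case/and3P=> cd /(face_uniq F_poly)[ab ac bc] /(face_uniq F_poly)[_ ad bd].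
by split; rewrite // eq_sym.
Qed.

Lemma ear_nbr b c d : is_ear b c d -> [/\ nbr F a b, nbr F a c & nbr F b c].
Proof.
case/and3P=> cd fF _; have [ab ac bc] := face_uniq F_poly fF.
by split; apply: (face_nbr fF); rewrite ?inE ?eqxx ?orbT.
Qed.

Lemma two_faces (K : {set {set 'I_n}}) f g h i j : polyhedron p K ->
  f \in K -> g \in K -> h \in K -> f != g -> i != j ->
  i \in f -> j \in f -> i \in g -> j \in g -> i \in h -> j \in h ->
  h = f \/ h = g.
Proof.
move=> K_poly fK gK hK fg ij fi fj gi gj hi hj.
have [k [_ _ _ H]] := other_face K_poly fK fi fj ij.
have [gf|->] := H g gK gi gj; first by rewrite gf eqxx in fg.
exact: H.
Qed.

Lemma ear_faces b c d f : is_ear b c d -> f \in F -> a \in f -> b \in f ->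
  f = [set a; b; c] \/ f = [set a; b; d].
Proof.
move=> ear fF fa fb; have [ba ca da bc [bd cd]] := ear_uniq ear.
case/and3P: ear => _ cF dF.
apply: (two_faces F_poly cF dF fF _ (_ : a != b));
  rewrite ?inE ?eqxx ?orbT // 1?eq_sym //.
apply/eqP => /setP/(_ c); rewrite !inE eqxx orbT.
by rewrite (negPf ca) (eq_sym c b) (negPf bc) (negPf cd).
Qed.

Lemma ear_side b c d : is_ear b c d -> exists N,
  [/\ dot N (X b) = 0, dot N (X c) = 0
    & forall j, j != a -> j != b -> j != c -> 0 < dot N (X j)].
Proof.
case/and3P=> _ fF _; have [u [e [uf uNf]]] := face_support F_poly F_convex fF.
have ua : dot u (p a) = e by rewrite uf // !inE eqxx.
have uray j : dot (- u) (X j) = e - dot u (p j).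
  by rewrite -ua /ray; vec_ring.
exists (- u); split; rewrite ?uray.
- by rewrite uf ?subrr // !inE eqxx orbT.
- by rewrite uf ?subrr // !inE eqxx orbT.
- move=> j ja jb jc; rewrite uray subr_gt0 uNf //.
  by rewrite !inE !negb_or ja jb jc.
Qed.

Lemma ear_det b c d : is_ear b c d -> det3 (X b) (X c) (X d) != 0.
Proof.
move=> ear; have [N [Nb Nc Nj]] := ear_side ear.
have [ba ca da bc [bd cd]] := ear_uniq ear.
have Nd : 0 < dot N (X d) by apply: Nj; rewrite // eq_sym.
case/and3P: ear => _ /(face_cross_neq0 F_poly) bc0 _.
set B := cross (X b) (X c).
have BB : dot B B != 0 by rewrite gt_eqF ?dot_gt0.
have : dot N (X d) * dot B B = dot N B * det3 (X b) (X c) (X d).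
  transitivity (dot N B * det3 (X b) (X c) (X d)
    - dot N (X b) * dot (cross (X c) (X d)) B
    - dot N (X c) * dot (cross (X d) (X b)) B); last first.
    by rewrite Nb Nc !mul0r !subr0.
  by rewrite /B; vec_ring.
apply: contra_eqN => /eqP ->; rewrite mulr0 mulf_neq0 // gt_eqF //.
Qed.

(** The linear form that is 1 on the ray of b and vanishes on those of c and d. *)
Definition ear_form b c d : 'rV[R]_3 :=
  (det3 (X b) (X c) (X d))^-1 *: cross (X c) (X d).

Lemma ear_form_tip b c d : is_ear b c d -> dot (ear_form b c d) (X b) = 1.
Proof.
move=> /ear_det D0; rewrite /ear_form dotZl.
by rewrite (_ : dot _ _ = det3 (X b) (X c) (X d)) ?mulVf //; vec_ring.
Qed.

Lemma ear_form_feet b c d :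
  dot (ear_form b c d) (X c) = 0 /\ dot (ear_form b c d) (X d) = 0.
Proof.
by rewrite /ear_form; move: (det3 _ _ _)^-1 => r; split; vec_ring.
Qed.

(** Seen from a, the whole surface lies in the angle at b between the planes of
    the faces abc and abd. *)
Lemma ear_coordinates b c d j : is_ear b c d -> j != a -> j != b ->
  exists be ga, [/\ X j = dot (ear_form b c d) (X j) *: X b
                            + be *: X c + ga *: X d,
    j != c -> 0 < ga & j != d -> 0 < be].
Proof.
move=> ear ja jb; have D0 := ear_det ear.
have [ba ca da bc [bd cd]] := ear_uniq ear.
have [N [Nb Nc Nj]] := ear_side ear.
have [M [Mb Md Mj]] : exists M, [/\ dot M (X b) = 0, dot M (X d) = 0
    & forall j, j != a -> j != b -> j != d -> 0 < dot M (X j)].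
  by apply: (@ear_side b d c); rewrite is_earC.
set A := dot (ear_form b c d) (X j).
pose be := det3 (X b) (X j) (X d) / det3 (X b) (X c) (X d).
pose ga := det3 (X b) (X c) (X j) / det3 (X b) (X c) (X d).
have jE : X j = A *: X b + be *: X c + ga *: X d.
  apply: (@scalerI _ _ (det3 (X b) (X c) (X d))) => //.
  rewrite scaler_comb3 (cramer3 _ _ _ (X j)) [det3 (X j) _ _]dotC.
  rewrite /be /ga /A /ear_form dotZl !mulrA.
  by rewrite ![det3 (X b) (X c) (X d) * _ / _]mulrAC !divff // !mul1r.
exists be, ga; split=> // [jc|jd].
- have := Nj j ja jb jc; rewrite {1}jE dot_comb3 Nb Nc !mulr0 !add0r.
  by rewrite pmulr_lgt0 // Nj // eq_sym.
- have := Mj j ja jb jd; rewrite {1}jE dot_comb3 Mb Md !mulr0 add0r addr0.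
  by rewrite pmulr_lgt0 // Mj // eq_sym.
Qed.

(** The other two coordinates of the ray of j are positive, and the support plane
    at the edge aj keeps that ray out of the cone over those of b, c, d. *)
Lemma ear_form_lt0 b c d j : is_ear b c d -> nbr F a j ->
  j != b -> j != c -> j != d -> dot (ear_form b c d) (X j) < 0.
Proof.
move=> ear aj jb jc jd; have ja : j != a by rewrite eq_sym (nbr_neq aj).
have [ba ca da bc [bd cd]] := ear_uniq ear.
have [be [ga [jE ga_gt0 be_gt0]]] := ear_coordinates ear ja jb.
have [L [Laj Lk]] := edge_support F_poly F_convex aj.
have L_lt0 k : k != a -> k != j -> dot L (X k) < 0.
  by move=> ka kj; rewrite /ray dotBr subr_lt0 Lk.
have Lj : dot L (X j) = 0 by rewrite /ray dotBr -Laj subrr.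
have := L_lt0 b ba; have := L_lt0 c ca; have := L_lt0 d da.
rewrite !(eq_sym _ j) jb jc jd => /(_ isT) Ld /(_ isT) Lc /(_ isT) Lb.
have := congr1 (dot L) jE; rewrite Lj dot_comb3.
have := ga_gt0 jc; have := be_gt0 jd; move: (dot (ear_form _ _ _) _) => al.
have [//|al_ge0] := ltrP al 0; nra.
Qed.

(** In a plane section of the cone at a, the chords cd and c'd' cut disjoint
    pieces off the two ends of the segment bb'; the product is the cross-ratio of
    the four points. It is computed by expanding the ray of b in the ear at b'. *)
Lemma ear_cross_ratio b c d b' c' d' : is_ear b c d -> is_ear b' c' d' ->
  b != b' -> b != c' -> b != d' -> b' != c -> b' != d ->
  ~~ ((c' \in [:: c; d]) && (d' \in [:: c; d])) ->
  1 < dot (ear_form b c d) (X b') * dot (ear_form b' c' d') (X b).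
Proof.
move=> ear ear' bb' bc' bd' b'c b'd ncd.
have [ba ca da bc [bd cd]] := ear_uniq ear.
have [b'a c'a d'a b'c' [b'd' c'd']] := ear_uniq ear'.
have [be [ga [bE ga_gt0 be_gt0]]] := ear_coordinates ear' ba bb'.
have := congr1 (dot (ear_form b c d)) bE.
rewrite dot_comb3 ear_form_tip //.
have [Ac Ad] := ear_form_feet b c d.
have le0 j : nbr F a j -> j != b -> dot (ear_form b c d) (X j) <= 0.
  move=> aj jb; have [->|jc] := eqVneq j c; first by rewrite Ac.
  have [->|jd] := eqVneq j d; first by rewrite Ad.
  exact/ltW/ear_form_lt0.
have lt0 j : nbr F a j -> j != b -> j \notin [:: c; d] ->
    dot (ear_form b c d) (X j) < 0.
  by move=> aj jb; rewrite !inE negb_or => /andP[jc jd]; apply: ear_form_lt0.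
have [_ ac' _] := ear_nbr ear'.
have [_ ad' _] : [/\ nbr F a b', nbr F a d' & nbr F b' d'].
  by apply: (@ear_nbr b' d' c'); rewrite is_earC.
have c'b : c' != b by rewrite eq_sym.
have d'b : d' != b by rewrite eq_sym.
have := le0 c' ac' c'b; have := le0 d' ad' d'b.
have := ga_gt0 bc'; have := be_gt0 bd'.
have : (dot (ear_form b c d) (X c') < 0) || (dot (ear_form b c d) (X d') < 0).
  by move: ncd; rewrite negb_and => /orP[] h; apply/orP; [left|right]; apply: lt0.
move: (dot (ear_form b c d) (X c')) (dot (ear_form b c d) (X d')) => x y.
move=> xy be0 ga0 y0 x0 ->.
by case/orP: xy => h; nra.
Qed.

(** By the minimum principle all radial velocities are nonnegative. As b is
    fixed, its neighbours off the ear have none, and the vanishing spreads from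
    the face next to abc around c. It could only stop at a vertex of the link of
    a, where the radial velocity is positive unless the vertex is b or d; but d
    is not a neighbour of c, and around c the vanishing cannot end at b alone. *)
Lemma no_flex_pinned_on_ear b c d v : is_ear b c d -> ~~ nbr F c d ->
  cap v -> v b = 0 -> v c = 0 -> v d = 0 ->
  (forall j, nbr F a j -> j != b -> j != c -> j != d -> 0 < rad v j) ->
  False.
Proof.
move=> ear ncd v_flex vb vc vd v_gt0.
have [ba ca da bc [bd cd]] := ear_uniq ear.
have rad0 i : v i = 0 -> rad v i = 0 by move=> vi; rewrite /rad vi dot0r.
have v_ge0 j : j != a -> 0 <= rad v j.
  apply: (radial_min_principle F_poly F_convex v_flex) => {}j aj.
  have [->|jb] := eqVneq j b; first by rewrite rad0.
  have [->|jc] := eqVneq j c; first by rewrite rad0.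
  have [->|jd] := eqVneq j d; first by rewrite rad0.
  exact/ltW/v_gt0.
have v_ge0' j : 0 <= rad v j.
  by have [->|] := eqVneq j a; [rewrite /radial /ray subrr dot0l|exact: v_ge0].
have nbr_b j : nbr F b j -> j != a -> j != c -> j != d -> rad v j = 0.
  move=> bj ja jc jd; have jb : j != b by rewrite eq_sym (nbr_neq bj).
  apply: (radial_spread F_poly F_convex v_flex ba vb) bj _ => //.
    move=> f k fF fb fa fk ka.
    have [->//|kb] := eqVneq k b.
    case: (ear_faces ear fF fa fb) => fE; move: fk; rewrite fE !inE.
      by rewrite (negPf ka) (negPf kb) => /eqP ->.
    by rewrite (negPf ka) (negPf kb) => /eqP ->.
  move=> f fF fb fj; apply/negP => fa.
  case: (ear_faces ear fF fa fb) => fE; move: fj; rewrite fE !inE.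
    by rewrite (negPf ja) (negPf jb) (negPf jc).
  by rewrite (negPf ja) (negPf jb) (negPf jd).
pose S := [set g in F | [&& c \in g, a \notin g & [forall i in g, rad v i == 0]]].
have abcF : [set a; b; c] \in F by case/and3P: ear.
have fb : b \in [set a; b; c] by rewrite !inE eqxx orbT.
have fc : c \in [set a; b; c] by rewrite !inE eqxx orbT.
have fa : a \in [set a; b; c] by rewrite !inE eqxx.
have [k [kF kf _ _]] := other_face F_poly abcF fb fc bc.
have [_ bk ck] := face_uniq F_poly kF.
have gb : b \in [set b; c; k] by rewrite !inE eqxx.
have gc : c \in [set b; c; k] by rewrite !inE eqxx orbT.
have gk : k \in [set b; c; k] by rewrite !inE eqxx orbT.
have ka : k != a by apply: contraNneq kf => ->.
have kd : k != d.
  apply: contraNneq ncd => <-; exact: (face_nbr kF).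
have gS : [set b; c; k] \in S.
  rewrite inE kF gc !inE !negb_or !(eq_sym a) ba ca ka /=.
  apply/forallP => i; apply/implyP; rewrite !inE => /orP[/orP[]|] /eqP ->.
  - by rewrite rad0.
  - by rewrite rad0.
  - by rewrite nbr_b ?eqxx // 1?eq_sym //; apply: face_nbr kF gb gk bk.
suff : [set a; b; c] \in S by rewrite inE fa /= !andbF.
apply: (@link_minus_vertex _ _ _ _ F_poly S c b _ _ [set b; c; k]) => //.
  by move=> g; rewrite inE => /and3P[].
move=> u g h ub uc gF hF cg ch ug uh; rewrite !inE.
move=> /and4P[_ _ ga /forallP g0]; rewrite hF ch /=.
have ua : u != a by apply: contraNneq ga => <-.
have ru : rad v u = 0 by have := g0 u; rewrite ug => /eqP.
have cu : nbr F c u by apply: face_nbr gF cg ug _; rewrite eq_sym.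
have ud : u != d by apply: contraNneq ncd => <-.
have auN : ~~ nbr F a u.
  by apply/negP => au; have := v_gt0 u au ub uc ud; rewrite ru ltxx.
have hNa : a \notin h.
  by apply: contra auN => ha; apply: face_nbr hF ha uh _; rewrite eq_sym.
rewrite hNa /=; apply/forallP => i; apply/implyP => hi.
have [->|iu] := eqVneq i u; first by rewrite ru.
apply/eqP/(radial_spread_interior F_poly F_convex v_flex ua auN ru) => //.
by apply: face_nbr hF uh hi _; rewrite eq_sym.
Qed.

(** Subtracting the rigid motion of bcd pins that triangle. Its translation part
    at a is the radial velocity of b times the form of the ear, as both vanish on
    the rays of c and d; this is what is subtracted from the radial velocities. *)
Lemma ear_bound b c d v : is_ear b c d -> ~~ nbr F c d -> cap v ->
  dot (p b - p c) (v b - v c) = 0 -> dot (p b - p d) (v b - v d) = 0 ->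
  dot (p c - p d) (v c - v d) = 0 ->
  rad v c = 0 -> rad v d = 0 ->
  (forall j, nbr F a j -> j != b -> j != c -> j != d ->
    rad v b * dot (ear_form b c d) (X j) < rad v j) ->
  False.
Proof.
move=> ear ncd v_flex vbc vbd vcd rc rd rj; have D0 := ear_det ear.
have [ba ca da bc [bd cd]] := ear_uniq ear.
have N0 : cross (X c - X b) (X d - X b) != 0.
  apply: contra D0 => /eqP N0; apply/eqP.
  transitivity (dot (X b) (cross (X c - X b) (X d - X b))); last by rewrite N0 dot0r.
  by move: (X b) (X c) (X d) => x y z; vec_ring.
have [|||tau [rho [bE cE dE]]] :=
    @triangle_motion R (X b) (X c) (X d) (v b) (v c) (v d) N0.
- by rewrite rayB.
- by rewrite rayB.
- by rewrite rayB.
pose w i := v i - (tau + cross rho (X i)).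
have wE i : rad w i = rad v i - dot tau (X i) by exact: radial_sub_motion.
have w0 i : v i = tau + cross rho (X i) -> w i = 0.
  by rewrite /w => ->; rewrite subrr.
have w0r i : v i = tau + cross rho (X i) -> rad v i = dot tau (X i).
  move=> /w0 wi; apply/eqP; rewrite -subr_eq0 -wE.
  by rewrite /rad wi dot0r.
apply: (@no_flex_pinned_on_ear b c d w) => //; try exact: w0.
  exact: cap_flex_sub_motion.
move=> j aj jb jc jd; have ja : j != a by rewrite eq_sym (nbr_neq aj).
have [be [ga [jE _ _]]] := ear_coordinates ear ja jb.
rewrite wE jE dot_comb3 -(w0r b) // -(w0r c) // -(w0r d) // rc rd.
by rewrite !mulr0 !addr0 subr_gt0 mulrC rj.
Qed.

End Ears.

(** * Flexes without radial part *)

Section RadialFreeFlexes.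

Variables (R : realType) (n : nat) (p : 'I_n -> 'rV[R]_3).
Variable K : {set {set 'I_n}}.
Hypothesis K_poly : polyhedron p K.
Variable a : 'I_n.

Local Open Scope set_scope.

Implicit Types (i j k : 'I_n) (f g h : {set 'I_n}).

Local Notation X := (ray p a).
Local Notation rad := (radial p a).

(** Every face turns about a; two faces with a common edge away from a turn
    alike, and so do all the faces around a vertex other than a. *)
Lemma radial_free_flex (v : 'I_n -> 'rV[R]_3) :
  (forall i j k, [set i; j; k] \in K -> a \notin [set i; j; k] ->
     det3 (X i) (X j) (X k) != 0) ->
  (forall i j, nbr K i j -> dot (p i - p j) (v i - v j) = 0) ->
  v a = 0 -> (forall i, rad v i = 0) ->
  exists rho, forall i, v i = cross rho (X i).
Proof.
move=> detK v_flex va v_rad.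
have Xa : X a = 0 by rewrite /ray subrr.
have turn g : g \in K -> exists rho, forall i, i \in g -> v i = cross rho (X i).
  move=> gK.
  have [i [j [k [gE ga]]]] : exists i j k, g = [set i; j; k] /\
      (a \notin [set i; j; k] \/ i = a).
    have [i [j [k [gE ij ik jk]]]] := face_vertices K_poly gK.
    have [|ga] := boolP (a \in g); last by exists i, j, k; split=> //; left; rewrite -gE.
    rewrite gE !inE => /orP[/orP[]|] /eqP ->.
    - by exists i, j, k; split=> //; right.
    - by exists j, k, i; split; [rewrite [RHS]set3_rot|right].
    - by exists k, i, j; split; [exact: set3_rot|right].
  rewrite gE in gK *; have [ij ik jk] := face_uniq K_poly gK.
  have side l m : l != m -> l \in [set i; j; k] -> m \in [set i; j; k] ->
      dot (X l - X m) (v l - v m) = 0.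
    by move=> lm gl gm; rewrite rayB v_flex //; apply: face_nbr gK gl gm lm.
  have gi : i \in [set i; j; k] by rewrite !inE eqxx.
  have gj : j \in [set i; j; k] by rewrite !inE eqxx orbT.
  have gk : k \in [set i; j; k] by rewrite !inE eqxx orbT.
  have N0 : cross (X j - X i) (X k - X i) != 0.
    by rewrite !rayB; apply: (face_cross_neq0 K_poly gK).
  have [tau [rho [iE jE kE]]] :=
    triangle_motion N0 (side i j ij gi gj) (side i k ik gi gk) (side j k jk gj gk).
  suff tau0 : tau = 0.
    exists rho => l; rewrite !inE => /orP[/orP[]|] /eqP ->.
    - by rewrite iE tau0 add0r.
    - by rewrite jE tau0 add0r.
    - by rewrite kE tau0 add0r.
  case: ga => [ga|ia]; last first.
    move: iE; rewrite ia va Xa => E; rewrite [RHS]E -[LHS]addr0; congr (_ + _).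
    by row_ring.
  have D0 := detK _ _ _ gK ga.
  have tau_rad l : v l = tau + cross rho (X l) -> dot (X l) tau = 0.
    move=> E; rewrite -(v_rad l) /radial E.
    by move: (X l) => y; vec_ring.
  apply: (@scalerI _ _ (det3 (X i) (X j) (X k))) => //; rewrite scaler0.
  transitivity (dot (X i) tau *: cross (X j) (X k)
    + dot (X j) tau *: cross (X k) (X i) + dot (X k) tau *: cross (X i) (X j)).
    by move: (X i) (X j) (X k) => x y z; row_ring.
  by rewrite !tau_rad // !scale0r !addr0.
have edge_indep i j : nbr K i j -> i != a -> j != a -> cross (X i) (X j) != 0.
  move=> ij ia ja; have [_ [g [gK gi gj]]] := nbrP _ _ _ ij.
  have [k [gE ki kj]] := face_third K_poly gK gi gj (nbr_neq ij).
  have [ga|ga] := boolP (a \in g); last first.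
    by rewrite gE in gK ga; apply: det3_cross_neq0 (detK _ _ _ gK ga).
  have ak : a = k.
    by move: ga; rewrite gE !inE !(eq_sym a) (negPf ia) (negPf ja) /= eq_sym => /eqP.
  rewrite gE -ak set3_rot in gK.
  exact: (face_cross_neq0 K_poly gK).
have [f0 f0K f0a] := poly_vertex K_poly a.
have [rho rhoE] := turn f0 f0K; exists rho.
pose G g := [forall i in g, v i == cross rho (X i)].
have Gedge g h i j : g \in K -> h \in K -> i != j -> i != a -> j != a ->
    i \in g -> j \in g -> i \in h -> j \in h -> G g -> G h.
  move=> gK hK ij ia ja gi gj hi hj /forallP Gg.
  have vE l : l \in g -> v l = cross rho (X l).
    by move=> gl; have := Gg l; rewrite gl => /eqP.
  have [sigma sE] := turn h hK.
  suff rs : sigma - rho = 0.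
    apply/forallP => l; apply/implyP => hl.
    by move/eqP: rs; rewrite subr_eq0 => /eqP <-; rewrite (sE l hl).
  have diff l : l \in g -> l \in h -> cross (sigma - rho) (X l) = 0.
    move=> gl hl; have /eqP := sE l hl.
    rewrite (vE l gl) eq_sym -subr_eq0 => /eqP <-.
    by move: (X l) => y; row_ring.
  apply: (cross_inj2 (edge_indep i j _ ia ja)); [|exact: diff..].
  exact: face_nbr gK gi gj ij.
have Garound x : x != a ->
    forall g h, g \in K -> h \in K -> x \in g -> x \in h -> G g -> G h.
  move=> xa g h gK hK gx hx Gg; pose S := [set f in K | (x \in f) && G f].
  suff: h \in S by rewrite inE => /and3P[].
  apply: (@link_minus_vertex _ _ _ _ K_poly S x a _ _ g) => //.
  - by move=> f; rewrite inE => /and3P[].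
  - move=> u f f' ua ux fK f'K fx f'x fu f'u; rewrite !inE => /and3P[_ _ Gf].
    by rewrite f'K f'x; apply: (Gedge f f' x u); rewrite // eq_sym.
  - by rewrite inE gK gx.
have Ga g h : g \in K -> h \in K -> a \in g -> a \in h -> G g -> G h.
  move=> gK hK ga ha Gg; pose S := [set f in K | (a \in f) && G f].
  suff: h \in S by rewrite inE => /and3P[].
  apply: (@link_minus_vertex _ _ _ _ K_poly S a a _ _ g) => //.
  - by move=> f; rewrite inE => /and3P[].
  - move=> u f f' ua _ fK f'K fx f'x fu f'u; rewrite !inE => /and3P[_ _ Gf].
    by rewrite f'K f'x; apply: (Garound u ua f).
  - by rewrite inE gK ga.
pose D i := [forall g in K, (i \in g) ==> G g].
have Gvertex i g : g \in K -> i \in g -> G g -> D i.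
  move=> gK gi Gg; apply/forallP => h; apply/implyP => hK; apply/implyP => hi.
  have [ia|ia] := eqVneq i a; last exact: (Garound i ia g).
  by rewrite ia in gi hi; apply: (Ga g).
have Da : D a.
  apply: (Gvertex a f0) => //; apply/forallP => i; apply/implyP => fi.
  by rewrite rhoE.
move=> i; have : D i.
  apply: (connected_closed K_poly (D := D) _ i Da) => j k Dj /nbrP[_ [g [gK gj gk]]].
  apply: (Gvertex k g) => //.
  by move/forallP/(_ g): Dj; rewrite gK gj.
have [g gK gi] := poly_vertex K_poly i.
move=> /forallP/(_ g); rewrite gK gi /= => /forallP/(_ i).
by rewrite gi => /eqP.
Qed.

End RadialFreeFlexes.

(** * Denting at edges that share a vertex *)

Section Dents.

Variables (R : realType) (n : nat) (p : 'I_n -> 'rV[R]_3).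
Variables F Q : {set {set 'I_n}}.
Hypothesis F_poly : polyhedron p F.
Hypothesis F_convex : strongly_strictly_convex p F.
Hypothesis Q_poly : polyhedron p Q.
Variable a : 'I_n.

Local Open Scope set_scope.

Implicit Types (i j k b c d x : 'I_n) (f g h : {set 'I_n}).

(** The dents (b, c, d) replace the faces abc and abd by acd and bcd. *)
Variable E : seq ('I_n * 'I_n * 'I_n).

Hypothesis E_ear : forall b c d, (b, c, d) \in E -> is_ear F a b c d.
Hypothesis E_apart : forall b c d b' c' d', (b, c, d) \in E -> (b', c', d') \in E ->
  (b, c, d) != (b', c', d') -> [/\ b != b', b != c' & b != d'].
Hypothesis Q_removed : forall f, f \in F ->
  (forall b c d, (b, c, d) \in E -> f != [set a; b; c] /\ f != [set a; b; d]) ->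
  f \in Q.
Hypothesis Q_added : forall b c d, (b, c, d) \in E ->
  [set a; c; d] \in Q /\ [set b; c; d] \in Q.
Hypothesis Q_face : forall f, f \in Q ->
  (f \in F /\
    forall b c d, (b, c, d) \in E -> f != [set a; b; c] /\ f != [set a; b; d]) \/
  exists b c d, (b, c, d) \in E /\ (f = [set a; c; d] \/ f = [set b; c; d]).

Local Notation X := (ray p a).
Local Notation rad := (radial p a).

Lemma far_face_kept f : f \in F -> a \notin f -> f \in Q.
Proof.
move=> fF fa; apply: Q_removed => // b c d _.
by split; apply: contraNneq fa => ->; rewrite !inE eqxx.
Qed.

Lemma ear_tip_not_nbr b c d g : (b, c, d) \in E -> g \in Q -> b \in g ->
  a \notin g.
Proof.
move=> bcd gQ gb; apply/negP => ga.
have [ba ca da bc [bd cd]] := ear_uniq F_poly (E_ear bcd).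
have [[gF /(_ _ _ _ bcd)[]]|] := Q_face gQ.
  by case: (ear_faces F_poly (E_ear bcd) gF ga gb) => ->; rewrite eqxx.
case=> b' [c' [d' [bcd' gE]]].
have [b'a c'a d'a _ _] := ear_uniq F_poly (E_ear bcd').
case: gE => gE; last first.
  by move: ga; rewrite gE !inE !(eq_sym a) (negPf b'a) (negPf c'a) (negPf d'a).
move: gb; rewrite gE !inE (negPf ba) /=.
have [[_ <- <-]|ne] := eqVneq (b, c, d) (b', c', d').
  by rewrite (negPf bc) (negPf bd).
by have [_ bc' bd'] := E_apart bcd bcd' ne; rewrite (negPf bc') (negPf bd').
Qed.

Lemma ear_tip_faces b c d g : (b, c, d) \in E -> g \in Q -> b \in g ->
  g \in F \/ g = [set b; c; d].
Proof.
move=> bcd gQ gb; have ga := ear_tip_not_nbr bcd gQ gb.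
have [[gF _]|] := Q_face gQ; first by left.
case=> b' [c' [d' [bcd' [gE|gE]]]]; first by move: ga; rewrite gE !inE eqxx.
have [[bb' cc' dd']|ne] := eqVneq (b, c, d) (b', c', d').
  by right; rewrite gE bb' cc' dd'.
have [bb' bc' bd'] := E_apart bcd bcd' ne.
by move: gb; rewrite gE !inE (negPf bb') (negPf bc') (negPf bd').
Qed.

(** The faces of the convex surface at an edge cd would survive the denting, hence
    would be acd and bcd; then bcd would be the only face left at bc. *)
Lemma chord_not_edge b c d : (b, c, d) \in E -> ~~ nbr F c d.
Proof.
move=> bcd; apply/negP => ncd.
have ear := E_ear bcd; have [ba ca da bc [bd cd]] := ear_uniq F_poly ear.
have [acdQ bcdQ] := Q_added bcd.
have acd_bcd : [set a; c; d] != [set b; c; d].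
  apply/eqP => /setP/(_ a); rewrite !inE eqxx /=.
  by rewrite !(eq_sym a) (negPf ba) (negPf ca) (negPf da).
have kept f : f \in F -> c \in f -> d \in f -> f \in Q.
  move=> fF fc fd; apply: Q_removed => // b' c' d' bcd'.
  have [b'c b'd] : c != b' /\ d != b'.
    have [[<- _ _]|ne] := eqVneq (b, c, d) (b', c', d').
      by rewrite !(eq_sym _ b).
    by rewrite eq_sym in ne; have [_] := E_apart bcd' bcd ne; rewrite !(eq_sym b').
  split; apply/eqP => fE; move: fc fd cd; rewrite fE !inE;
    rewrite (negPf ca) (negPf da) (negPf b'c) (negPf b'd);
    by move=> /eqP -> /eqP ->; rewrite eqxx.
have chord f : f \in F -> c \in f -> d \in f ->
    f = [set a; c; d] \/ f = [set b; c; d].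
  move=> fF fc fd.
  by apply: (two_faces Q_poly acdQ bcdQ (kept f fF fc fd) acd_bcd cd);
    rewrite ?inE ?eqxx ?orbT.
have bcdF : [set b; c; d] \in F.
  have [k [k' [kk' kF k'F _]]] := edge_faces F_poly ncd.
  have [_ ck dk] := face_uniq F_poly kF; have [_ ck' dk'] := face_uniq F_poly k'F.
  case: (chord _ kF) => [||kE|<-//]; rewrite ?inE ?eqxx ?orbT //.
  case: (chord _ k'F) => [||k'E|<-//]; rewrite ?inE ?eqxx ?orbT //.
  have : k \in [set c; d; k] by rewrite !inE eqxx orbT.
  have : k' \in [set c; d; k'] by rewrite !inE eqxx orbT.
  rewrite kE k'E !inE !(eq_sym _ c) !(eq_sym _ d).
  rewrite (negPf ck) (negPf dk) (negPf ck') (negPf dk') !orbF.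
  by move=> /eqP k'a /eqP ka; rewrite k'a ka eqxx in kk'.
have gb : b \in [set b; c; d] by rewrite !inE eqxx.
have gc : c \in [set b; c; d] by rewrite !inE eqxx orbT.
have [k [kQ _ kne _]] := other_face Q_poly bcdQ gb gc bc.
have kb : b \in [set b; c; k] by rewrite !inE eqxx.
have kc : c \in [set b; c; k] by rewrite !inE eqxx orbT.
have ka := ear_tip_not_nbr bcd kQ kb.
case: (ear_tip_faces bcd kQ kb) => [kF|kE]; last by rewrite kE eqxx in kne.
have abcF : [set a; b; c] \in F by case/and3P: ear.
have [aa [ab ac]] :
    a \in [set a; b; c] /\ b \in [set a; b; c] /\ c \in [set a; b; c].
  by rewrite !inE !eqxx !orbT.
have ga : a \notin [set b; c; d] by rewrite !inE !negb_or !(eq_sym a) ba ca da.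
have abc_bcd : [set a; b; c] != [set b; c; d] by apply: contraNneq ga => <-.
case: (two_faces F_poly abcF bcdF kF abc_bcd bc) => // kE.
  by rewrite kE aa in ka.
by rewrite kE eqxx in kne.
Qed.

(** Two dents with the same chord would leave acd as the only face at ac. *)
Lemma distinct_chords b c d b' c' d' : (b, c, d) \in E -> (b', c', d') \in E ->
  (b, c, d) != (b', c', d') -> ~~ ((c' \in [:: c; d]) && (d' \in [:: c; d])).
Proof.
move=> bcd bcd' ne; apply/negP => /andP[c'cd d'cd].
have [bb' bc' bd'] := E_apart bcd bcd' ne.
have [ba ca da bc [bd cd]] := ear_uniq F_poly (E_ear bcd).
have [b'a c'a d'a b'c' [b'd' c'd']] := ear_uniq F_poly (E_ear bcd').
have cE : c \in [:: c'; d'].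
  move: c'cd d'cd c'd'; rewrite !inE => /orP[] /eqP -> /orP[] /eqP ->;
    by rewrite ?eqxx ?orbT.
have ac : a != c by rewrite eq_sym.
have [acdQ _] := Q_added bcd.
have aa : a \in [set a; c; d] by rewrite !inE eqxx.
have cc : c \in [set a; c; d] by rewrite !inE eqxx orbT.
have [k [kQ _ kne _]] := other_face Q_poly acdQ aa cc ac.
have ka : a \in [set a; c; k] by rewrite !inE eqxx.
have kc : c \in [set a; c; k] by rewrite !inE eqxx orbT.
have [/and3P[_ abcF _] /and3P[_ ab'c'F ab'd'F]] := (E_ear bcd, E_ear bcd').
(* the two faces of the convex surface at the edge ac have been removed *)
have ab'cF : [set a; b'; c] \in F by move: cE; rewrite !inE => /orP[] /eqP ->.
have abc_ab'c : [set a; b; c] != [set a; b'; c].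
  apply/eqP => /setP/(_ b); rewrite !inE eqxx orbT (negPf ba) (negPf bb') (negPf bc).
  by [].
have F_ac f : f \in F -> a \in f -> c \in f ->
    f = [set a; b; c] \/ f = [set a; b'; c].
  move=> fF fa fc.
  by apply: (two_faces F_poly abcF ab'cF fF abc_ab'c ac);
    rewrite ?inE ?eqxx ?orbT.
have tips f b0 c0 d0 : (b0, c0, d0) \in E -> b0 \in f -> a \in f -> f \in Q -> False.
  by move=> bcd0 fb0 fa fQ; have := ear_tip_not_nbr bcd0 fQ fb0; rewrite fa.
have [[kF _]|] := Q_face kQ.
  case: (F_ac _ kF ka kc) => kE.
    by apply: (tips _ b c d bcd _ ka kQ); rewrite kE !inE eqxx orbT.
  by apply: (tips _ b' c' d' bcd' _ ka kQ); rewrite kE !inE eqxx orbT.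
case=> b2 [c2 [d2 [bcd2 kE]]].
have [b2a c2a d2a b2c2 [b2d2 c2d2]] := ear_uniq F_poly (E_ear bcd2).
case: kE => kE; last first.
  by move: ka; rewrite kE !inE !(eq_sym a) (negPf b2a) (negPf c2a) (negPf d2a).
have cE2 : (c == c2) || (c == d2) by move: kc; rewrite kE !inE (negPf ca).
have ab2cF : [set a; b2; c] \in F.
  by have /and3P[_ ? ?] := E_ear bcd2; move: cE2 => /orP[] /eqP ->.
have ab2c_a : a \in [set a; b2; c] by rewrite !inE eqxx.
have ab2c_c : c \in [set a; b2; c] by rewrite !inE eqxx orbT.
have b2c : b2 != c by move: cE2 => /orP[] /eqP ->.
have : b2 \in [set a; b2; c] by rewrite !inE eqxx orbT.
case: (F_ac _ ab2cF ab2c_a ab2c_c) => ->;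
  rewrite !inE (negPf b2a) (negPf b2c) orbF /=.
  move=> /eqP b2b; have [[_ c2c d2d]|ne2] := eqVneq (b2, c2, d2) (b, c, d).
    by rewrite kE c2c d2d eqxx in kne.
  by have [] := E_apart bcd2 bcd ne2; rewrite b2b eqxx.
move=> /eqP b2b'; have [[_ c2c' d2d']|ne2] := eqVneq (b2, c2, d2) (b', c', d').
  rewrite kE c2c' d2d' in kne; case/eqP: kne; apply/setP => x; rewrite !inE.
  move: c'cd d'cd c'd'; rewrite !inE => /orP[] /eqP -> /orP[] /eqP ->;
    by rewrite ?eqxx // orbAC.
by have [] := E_apart bcd2 bcd' ne2; rewrite b2b' eqxx.
Qed.

Lemma link_kept x : nbr F a x ->
  (forall b c d, (b, c, d) \in E -> x != b) -> nbr Q a x.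
Proof.
move=> ax tip; have [axN [g [gF ga gx]]] := nbrP _ _ _ ax.
have xa : x != a by rewrite eq_sym.
pose removed := [exists t : 'I_n * 'I_n * 'I_n, (t \in E) &&
  ((g == [set a; t.1.1; t.1.2]) || (g == [set a; t.1.1; t.2]))].
have [/existsP[[[b c] d] /= /andP[bcd gE]]|N] := boolP removed; last first.
  apply: (face_nbr _ ga gx axN); apply: Q_removed => // b c d bcd.
  split; apply: contraNneq N => gE; apply/existsP; exists (b, c, d);
    by rewrite bcd gE eqxx ?orbT.
have [acdQ _] := Q_added bcd; have xb := tip _ _ _ bcd.
apply: (face_nbr acdQ); rewrite ?inE ?eqxx //.
by case/orP: gE => /eqP gE; move: gx;
  rewrite gE !inE (negPf xa) (negPf xb) /= => /eqP ->; rewrite eqxx ?orbT.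
Qed.

Lemma far_face_det i j k : [set i; j; k] \in Q -> a \notin [set i; j; k] ->
  det3 (X i) (X j) (X k) != 0.
Proof.
move=> gQ ga; have [[gF _]|] := Q_face gQ; first exact: face_det gF ga.
case=> b [c [d [bcd gE]]].
case: gE => gE; first by rewrite gE !inE eqxx in ga.
have D0 := ear_det F_poly F_convex (E_ear bcd).
have [ij ik jk] := face_uniq Q_poly gQ.
have : i \in [set b; c; d] by rewrite -gE !inE eqxx.
have : j \in [set b; c; d] by rewrite -gE !inE eqxx orbT.
have : k \in [set b; c; d] by rewrite -gE !inE eqxx orbT.
move: ij ik jk; rewrite !inE.
move=> ij ik jk /orP[/orP[]|] /eqP kE /orP[/orP[]|] /eqP jE /orP[/orP[]|] /eqP iE;
  move: ij ik jk; rewrite iE jE kE ?eqxx // => _ _ _;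
  by rewrite ?(det3_perm (X b) (X c) (X d)) ?oppr_eq0.
Qed.

Definition dented_flex (v : 'I_n -> 'rV[R]_3) : Prop :=
  v a = 0 /\ forall i j, nbr Q i j -> dot (p i - p j) (v i - v j) = 0.

Lemma dented_flex_opp v : dented_flex v -> dented_flex (fun i => - v i).
Proof.
move=> [va v_flex]; split=> [|i j ij]; first by rewrite va oppr0.
by rewrite -opprD dotNr v_flex ?oppr0.
Qed.

Lemma radial_opp v i : rad (fun i => - v i) i = - rad v i.
Proof. by rewrite /radial dotNr. Qed.

Lemma dented_flex_cap v : dented_flex v -> cap_flex p F a v.
Proof.
move=> [_ v_flex] f i j fF fa fi fj.
have [->|ij] := eqVneq i j; first by rewrite subrr dot0l.
by apply: v_flex; apply: face_nbr fi fj ij; apply: far_face_kept.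
Qed.

Lemma radial_link v x : dented_flex v -> nbr F a x ->
  (forall b c d, (b, c, d) \in E -> x != b) -> rad v x = 0.
Proof.
move=> [va v_flex] ax tip.
have := v_flex _ _ (link_kept ax tip); rewrite va.
rewrite /radial /ray => H.
transitivity (- (- dot (p x - p a) (v x))); first by rewrite opprK.
by rewrite -[RHS]H; vec_ring.
Qed.

(** Off the tips, the link of a survives in the dented surface and has no radial
    velocity, while the form of the ear is negative there: only the tips of the
    other dents can prevent the bound of the ear from being contradictory. *)
Lemma tip_bound b c d v : (b, c, d) \in E -> dented_flex v -> 0 < rad v b ->
  (forall b' c' d', (b', c', d') \in E -> (b, c, d) != (b', c', d') ->
    rad v b * dot (ear_form p a b c d) (X b') < rad v b') -> False.
Proof.
move=> bcd vQ vb vb'; have ear := E_ear bcd.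
have [ba ca da bc [bd cd]] := ear_uniq F_poly ear.
have [_ bcdQ] := Q_added bcd.
have side i j : i \in [set b; c; d] -> j \in [set b; c; d] -> i != j ->
    dot (p i - p j) (v i - v j) = 0.
  by move=> gi gj ij; apply: vQ.2; apply: face_nbr bcdQ gi gj ij.
have [gb [gc gd]] :
    b \in [set b; c; d] /\ c \in [set b; c; d] /\ d \in [set b; c; d].
  by rewrite !inE !eqxx !orbT.
have foot x : x \in [:: c; d] -> rad v x = 0.
  rewrite !inE => xcd; apply: radial_link => //.
    case/orP: xcd => /eqP ->; first by have [] := ear_nbr F_poly ear.
    by rewrite is_earC in ear; have [] := ear_nbr F_poly ear.
  move=> b' c' d' bcd'.
  have [[<- _ _]|ne] := eqVneq (b, c, d) (b', c', d').
    by case/orP: xcd => /eqP ->; rewrite eq_sym.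
  rewrite eq_sym in ne; have [_ b'c b'd] := E_apart bcd' bcd ne.
  by case/orP: xcd => /eqP ->; rewrite eq_sym.
apply: (ear_bound F_poly F_convex ear (chord_not_edge bcd) (dented_flex_cap vQ)).
- exact: side.
- exact: side.
- exact: side.
- by rewrite foot // !inE eqxx.
- by rewrite foot // !inE eqxx orbT.
move=> j aj jb jc jd.
pose tip := [exists t : 'I_n * 'I_n * 'I_n, (t \in E) && (j == t.1.1)].
have [/existsP[[[b' c'] d'] /= /andP[bcd' /eqP jE]]|N] := boolP tip.
  rewrite jE; apply: vb' bcd' _; apply: contraNneq jb => -[bb' _ _].
  by rewrite jE bb'.
rewrite (radial_link vQ aj) => [|b' c' d' bcd'].
  by rewrite pmulr_rlt0 //; apply: (ear_form_lt0 F_poly F_convex).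
by apply: contraNneq N => jE; apply/existsP; exists (b', c', d'); rewrite bcd' jE /=.
Qed.

Lemma tip_bound_opp b c d v : (b, c, d) \in E -> dented_flex v -> rad v b < 0 ->
  (forall b' c' d', (b', c', d') \in E -> (b, c, d) != (b', c', d') ->
    rad v b' < rad v b * dot (ear_form p a b c d) (X b')) -> False.
Proof.
move=> bcd vQ vb vb'; apply: (tip_bound bcd (dented_flex_opp vQ)).
  by rewrite radial_opp oppr_gt0.
move=> b' c' d' bcd' ne; rewrite !radial_opp mulNr ltrN2.
exact: vb' bcd' ne.
Qed.

(** The minimum principle for v and for -v makes the radial part vanish. *)
Lemma rigid_of_tips v : dented_flex v ->
  (forall b c d, (b, c, d) \in E -> rad v b = 0) ->
  exists rho, forall i, v i = cross rho (X i).
Proof.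
move=> vQ tips.
have link j : nbr F a j -> rad v j = 0.
  move=> aj; pose tip := [exists t : 'I_n * 'I_n * 'I_n, (t \in E) && (j == t.1.1)].
  have [/existsP[[[b c] d] /= /andP[bcd /eqP ->]]|N] := boolP tip.
    exact: tips bcd.
  apply: radial_link => // b c d bcd; apply: contraNneq N => jE.
  by apply/existsP; exists (b, c, d); rewrite bcd jE /=.
apply: (radial_free_flex Q_poly far_face_det vQ.2 vQ.1) => i.
have [->|ia] := eqVneq i a; first by rewrite /radial vQ.1 dot0r.
apply/eqP; rewrite eq_le.
rewrite (radial_min_principle F_poly F_convex (dented_flex_cap vQ)) ?andbT //;
  last by move=> j /link ->.
rewrite -oppr_ge0 -radial_opp.
apply: (radial_min_principle F_poly F_convex) => //.
  exact: dented_flex_cap (dented_flex_opp vQ).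
by move=> j /link; rewrite radial_opp => ->; rewrite oppr0.
Qed.

Lemma rigid_one_dent b c d v : E = [:: (b, c, d)] -> dented_flex v ->
  exists rho, forall i, v i = cross rho (X i).
Proof.
move=> EE vQ; apply: rigid_of_tips => // b1 c1 d1.
rewrite EE inE => /eqP[-> _ _].
have bcd : (b, c, d) \in E by rewrite EE inE.
have no b' c' d' : (b', c', d') \in E -> (b, c, d) != (b', c', d') -> False.
  by rewrite EE inE => /eqP ->; rewrite eqxx.
have [vb|vb|//] := ltgtP (rad v b) 0.
  by case: (tip_bound_opp bcd vQ vb) => b' c' d' bcd' /(no _ _ _ bcd').
by case: (tip_bound bcd vQ vb) => b' c' d' bcd' /(no _ _ _ bcd').
Qed.

(** Let s and t be the radial velocities of the tips, r and r' the negative values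
    of the form of each ear at the tip of the other. The bounds of the two ears
    make s and t of opposite signs with |t| >= |r s| and |s| >= |r' t|, which is
    impossible for nonzero s and t since r r' > 1. *)
Lemma rigid_two_dents b c d b' c' d' v : E = [:: (b, c, d); (b', c', d')] ->
  (b, c, d) != (b', c', d') -> dented_flex v ->
  exists rho, forall i, v i = cross rho (X i).
Proof.
move=> EE ne vQ.
have ne' : (b', c', d') != (b, c, d) by rewrite eq_sym.
have bcd : (b, c, d) \in E by rewrite EE !inE eqxx.
have bcd' : (b', c', d') \in E by rewrite EE !inE eqxx orbT.
have other (P : 'I_n -> Prop) t1 t2 : E =i [:: t1; t2] ->
    P t2.1.1 -> forall b2 c2 d2, (b2, c2, d2) \in E -> t1 != (b2, c2, d2) -> P b2.
  move=> E12 P2 b2 c2 d2; rewrite E12 !inE => /orP[] /eqP t2E.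
    by rewrite t2E eqxx.
  by move: P2; rewrite -t2E.
have E1 : E =i [:: (b, c, d); (b', c', d')] by rewrite EE.
have E2 : E =i [:: (b', c', d'); (b, c, d)] by move=> t; rewrite EE !inE orbC.
have [bb' bc' bd'] := E_apart bcd bcd' ne.
have [_ b'c b'd] := E_apart bcd' bcd ne'.
have [ba ca da bc [bd cd]] := ear_uniq F_poly (E_ear bcd).
have [b'a c'a d'a b'c' [b'd' c'd']] := ear_uniq F_poly (E_ear bcd').
have ratio := ear_cross_ratio F_poly F_convex (E_ear bcd) (E_ear bcd')
  bb' bc' bd' b'c b'd (distinct_chords bcd bcd' ne).
set r := dot (ear_form p a b c d) (X b') in ratio.
set r' := dot (ear_form p a b' c' d') (X b) in ratio.
have r_lt0 : r < 0.
  have [ab' _ _] := ear_nbr F_poly (E_ear bcd').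
  by apply: (ear_form_lt0 F_poly F_convex (E_ear bcd)); rewrite // eq_sym.
have r'_lt0 : r' < 0.
  have [ab _ _] := ear_nbr F_poly (E_ear bcd).
  by apply: (ear_form_lt0 F_poly F_convex (E_ear bcd')).
pose s := rad v b; pose t := rad v b'.
have H1 : 0 < s -> s * r < t -> False.
  move=> s0 st; apply: (tip_bound bcd vQ s0) => b2 c2 d2.
  exact: (other (fun x => s * dot (ear_form p a b c d) (X x) < rad v x)
    _ _ E1 st).
have H2 : s < 0 -> t < s * r -> False.
  move=> s0 st; apply: (tip_bound_opp bcd vQ s0) => b2 c2 d2.
  exact: (other (fun x => rad v x < s * dot (ear_form p a b c d) (X x))
    _ _ E1 st).
have H3 : 0 < t -> t * r' < s -> False.
  move=> s0 st; apply: (tip_bound bcd' vQ s0) => b2 c2 d2.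
  exact: (other (fun x => t * dot (ear_form p a b' c' d') (X x) < rad v x)
    _ _ E2 st).
have H4 : t < 0 -> s < t * r' -> False.
  move=> s0 st; apply: (tip_bound_opp bcd' vQ s0) => b2 c2 d2.
  exact: (other (fun x => rad v x < t * dot (ear_form p a b' c' d') (X x))
    _ _ E2 st).
have st0 : s = 0 /\ t = 0.
  have [s0|s0|s0] := ltgtP s 0.
  - have t_ge : s * r <= t by rewrite leNgt; apply/negP => /(H2 s0).
    have t0 : 0 < t by apply: lt_le_trans t_ge; rewrite nmulr_rgt0.
    by case: (H3 t0); nra.
  - have t_le : t <= s * r by rewrite leNgt; apply/negP => /(H1 s0).
    have t0 : t < 0 by apply: le_lt_trans t_le _; rewrite pmulr_rlt0.
    by case: (H4 t0); nra.
  - split=> //; have [t0|t0|//] := ltgtP t 0.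
      by case: (H4 t0); rewrite s0 nmulr_rgt0.
    by case: (H3 t0); rewrite s0 pmulr_rlt0.
apply: rigid_of_tips => // b2 c2 d2.
rewrite EE !inE => /orP[] /eqP[-> _ _]; [exact: st0.1|exact: st0.2].
Qed.

End Dents.

Section DentedSurface.

Variables (R : realType) (n : nat) (p : 'I_n -> 'rV[R]_3).

Local Open Scope set_scope.

Implicit Types (a b c d v : 'I_n) (F G Q : {set {set 'I_n}}) (e f : {set 'I_n}).

Lemma dent_at_vertex F e G v : dent_at F e G -> v \in e -> exists b c d,
  [/\ e = [set v; b], uniq [:: v; b; c; d],
      [set v; b; c] \in F, [set v; b; d] \in F
    & G = (F :\: [set [set v; b; c]; [set v; b; d]])
            :|: [set [set v; c; d]; [set b; c; d]]].
Proof.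
case=> a [b [c [d [u eE abc abd GE]]]].
have GE' : G = (F :\: [set [set a; b; c]; [set a; b; d]])
            :|: [set [set a; c; d]; [set b; c; d]] by rewrite GE !(set3_rot c d).
rewrite eE !inE => /orP[] /eqP ->; first by exists b, c, d.
exists a, c, d; split=> //.
- by rewrite finset.setUC.
- by move: u; rewrite /= !inE !negb_or (eq_sym b a); do !case: (_ == _).
- by rewrite (finset.setUC [set b]).
- by rewrite (finset.setUC [set b]).
- rewrite GE' (finset.setUC [set b] [set a]); congr (_ :|: _).
  by rewrite finset.setUC.
Qed.

Lemma infinitesimally_rigid_of_rotations Q a :
  (forall v : 'I_n -> 'rV[R]_3, dented_flex p Q a v ->
    exists rho, forall i, v i = cross rho (ray p a i)) ->
  infinitesimally_rigid p Q.
Proof.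
move=> rigid p' p'_flex.
have [|rho rhoE] := rigid (fun i => p' i - p' a).
  split=> [|i j ij]; first by rewrite subrr.
  by rewrite opprB addrA subrK; apply: p'_flex.
exists (fun x => p' a + cross rho (x - p a)).
  exact: rotation_congruence_derivative.
by move=> i; rewrite -rhoE addrC subrK.
Qed.

End DentedSurface.

(** * Dented surfaces *)

Section DentFaces.

Variable n : nat.

Local Open Scope set_scope.

Implicit Types (v b c d : 'I_n) (F G Q : {set {set 'I_n}}) (f : {set 'I_n}).

Lemma mem_dent F v b c d f :
  reflect ([/\ f \in F, f != [set v; b; c] & f != [set v; b; d]] \/
           (f = [set v; c; d] \/ f = [set b; c; d]))
    (f \in (F :\: [set [set v; b; c]; [set v; b; d]])
             :|: [set [set v; c; d]; [set b; c; d]]).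
Proof.
rewrite !inE negb_or; apply: (iffP orP) => -[].
- by move=> /andP[/andP[? ?] ?]; left.
- by move=> /orP[] /eqP ->; right; [left|right].
- by case=> -> -> ->; left.
- by move=> fE; right; case: fE => ->; rewrite eqxx ?orbT.
Qed.

End DentFaces.

Section Main.

Variables (R : realType) (n : nat) (p : 'I_n -> 'rV[R]_3).
Variables F Q : {set {set 'I_n}}.
Hypothesis F_poly : polyhedron p F.
Hypothesis F_convex : strongly_strictly_convex p F.
Hypothesis Q_poly : polyhedron p Q.

Local Open Scope set_scope.

Implicit Types (v b c d : 'I_n) (e f : {set 'I_n}).

Lemma one_dent_rigid e : dent_at F e Q -> infinitesimally_rigid p Q.
Proof.
move=> dent; have [v ve] : exists v, v \in e.
  by case: dent => v [b [_ [_ [_ -> _ _ _]]]]; exists v; rewrite !inE eqxx.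
have [b [c [d [_ u vbc vbd QE]]]] := dent_at_vertex dent ve.
have memQ := mem_dent F v b c d; rewrite -QE in memQ.
apply: (@infinitesimally_rigid_of_rotations _ _ _ _ v) => w.
apply: (@rigid_one_dent _ _ _ F Q F_poly F_convex Q_poly v [:: (b, c, d)]
  _ _ _ _ _ b c d) => //.
- move=> b1 c1 d1; rewrite inE => /eqP[-> -> ->]; rewrite /is_ear vbc vbd !andbT.
  by move: u => /= /and4P[_ _]; rewrite !inE.
- move=> b1 c1 d1 b2 c2 d2; rewrite !inE => /eqP -> /eqP ->.
  by rewrite eqxx.
- move=> f fF H; apply/memQ; left; have [] := H b c d; rewrite ?inE //.
- move=> b1 c1 d1; rewrite inE => /eqP[-> -> ->].
  by split; apply/memQ; right; [left|right].
- move=> f /memQ[[fF f1 f2]|fE]; [left|right].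
    by split=> // b1 c1 d1; rewrite inE => /eqP[-> -> ->].
  by exists b, c, d; rewrite inE eqxx.
Qed.

Lemma two_dents_rigid e1 e2 F1 v : e1 <> e2 -> v \in e1 -> v \in e2 ->
  ~ (exists2 f, f \in F & e1 \subset f /\ e2 \subset f) ->
  dent_at F e1 F1 -> dent_at F1 e2 Q -> infinitesimally_rigid p Q.
Proof.
move=> e12 ve1 ve2 apart dent1 dent2.
have [b [c [d [e1E u vbc vbd F1E]]]] := dent_at_vertex dent1 ve1.
have [b' [c' [d' [e2E u' vb'c' vb'd' QE]]]] := dent_at_vertex dent2 ve2.
have memF1 := mem_dent F v b c d; rewrite -F1E in memF1.
have memQ := mem_dent F1 v b' c' d'; rewrite -QE in memQ.
have bb' : b != b' by apply/eqP => bb'; rewrite e1E e2E bb' in e12.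
have [vb vc vd] : [/\ v != b, v != c & v != d].
  by move: u => /= /and4P[]; rewrite !inE !negb_or => /and3P[].
have [bc bd cd] : [/\ b != c, b != d & c != d].
  by move: u => /= /and4P[_]; rewrite !inE !negb_or => /andP[? ?] ? _.
have [vb' vc' vd'] : [/\ v != b', v != c' & v != d'].
  by move: u' => /= /and4P[]; rewrite !inE !negb_or => /and3P[].
have [b'c' b'd' c'd'] : [/\ b' != c', b' != d' & c' != d'].
  by move: u' => /= /and4P[_]; rewrite !inE !negb_or => /andP[? ?] ? _.
have no_face f : f \in F -> v \in f -> b \in f -> b' \in f -> False.
  move=> fF fv fb fb'; apply: apart; exists f => //.
  rewrite e1E e2E; split; apply/fintype.subsetP => x;
    by rewrite !inE => /orP[] /eqP ->.
have mem3 (x y z : 'I_n) : [/\ x \in [set x; y; z], y \in [set x; y; z]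
    & z \in [set x; y; z]] by rewrite !inE !eqxx !orbT.
have b'c : b' != c.
  have [x1 x2 x3] := mem3 v b c.
  by apply/eqP => E; apply: (no_face _ vbc x1 x2); rewrite E.
have b'd : b' != d.
  have [x1 x2 x3] := mem3 v b d.
  by apply/eqP => E; apply: (no_face _ vbd x1 x2); rewrite E.
have vNbcd : v \notin [set b; c; d] by rewrite !inE !negb_or vb vc vd.
have b'Nvcd : b' \notin [set v; c; d].
  by rewrite !inE !negb_or (eq_sym b') vb' b'c b'd.
have inF x : [set v; b'; x] \in F1 -> [set v; b'; x] \in F.
  have [x1 x2 x3] := mem3 v b' x.
  case/memF1 => [[]//|[] E]; first by rewrite -E x2 in b'Nvcd.
  by rewrite -E x1 in vNbcd.
have {}vb'c' := inF _ vb'c'; have {}vb'd' := inF _ vb'd'.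
have bc' : b != c'.
  have [x1 x2 x3] := mem3 v b' c'.
  by apply/eqP => E; apply: (no_face _ vb'c' x1 _ x2); rewrite E.
have bd' : b != d'.
  have [x1 x2 x3] := mem3 v b' d'.
  by apply/eqP => E; apply: (no_face _ vb'd' x1 _ x2); rewrite E.
have kept f : f \in F1 -> (v \notin f) || (b' \notin f) -> f \in Q.
  move=> fF1 fN; apply/memQ; left.
  by split=> //; apply: contraTneq fN => ->; rewrite !inE !eqxx !orbT.
apply: (@infinitesimally_rigid_of_rotations _ _ _ _ v) => w.
apply: (@rigid_two_dents _ _ _ F Q F_poly F_convex Q_poly v
  [:: (b, c, d); (b', c', d')] _ _ _ _ _ b c d b' c' d') => //.
- move=> b1 c1 d1; rewrite !inE => /orP[] /eqP[-> -> ->]; rewrite /is_ear.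
    by rewrite vbc vbd cd.
  by rewrite vb'c' vb'd' c'd'.
- move=> b1 c1 d1 b2 c2 d2; rewrite !inE.
  move=> /orP[] /eqP[-> -> ->] /orP[] /eqP[-> -> ->]; rewrite ?eqxx // => _.
  by rewrite (eq_sym b').
- move=> f fF H.
  have [|f1 f2] := H b c d; first by rewrite !inE eqxx.
  have [|f3 f4] := H b' c' d'; first by rewrite !inE eqxx orbT.
  by apply/memQ; left; split=> //; apply/memF1; left.
- move=> b1 c1 d1; rewrite !inE => /orP[] /eqP[-> -> ->]; split.
  + by apply: kept; [apply/memF1; right; left|rewrite b'Nvcd orbT].
  + by apply: kept; [apply/memF1; right; right|rewrite vNbcd].
  + by apply/memQ; right; left.
  + by apply/memQ; right; right.
- move=> f /memQ[[/memF1[[fF f1 f2]|fE] f3 f4]|fE]; [left|right|right].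
  + by split=> // b1 c1 d1; rewrite !inE => /orP[] /eqP[-> -> ->].
  + by exists b, c, d; rewrite !inE eqxx.
  + by exists b', c', d'; rewrite !inE eqxx orbT.
- by apply: contraNneq bb' => -[-> _ _].
Qed.

End Main.

Theorem theorem1p4 (R : realType) (n : nat) (p : 'I_n -> 'rV[R]_3)
    (F Q : {set {set 'I_n}})
    (F_polyhedron : polyhedron p F)
    (F_convex : strongly_strictly_convex p F)
    (Q_polyhedron : polyhedron p Q)
    (Q_dented :
      (exists e : {set 'I_n}, dent_at F e Q) \/
      (exists e1 e2 : {set 'I_n},
        [/\ is_edge F e1 /\ is_edge F e2,
            e1 <> e2,
            (exists v : 'I_n, v \in e1 /\ v \in e2),
            ~ (exists2 f : {set 'I_n}, f \in F & e1 \subset f /\ e2 \subset f)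
          & (exists2 F1 : {set {set 'I_n}}, dent_at F e1 F1 & dent_at F1 e2 Q)])) :
  infinitesimally_rigid p Q.
Proof.
case: Q_dented => [[e dent]|[e1 [e2 [_ e12 [v [ve1 ve2]] apart [F1 dent1 dent2]]]]].
  exact: one_dent_rigid dent.
exact: (two_dents_rigid F_polyhedron F_convex Q_polyhedron e12 ve1 ve2 apart
  dent1 dent2).
Qed.
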